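(* Let $n,r\ge 1$, let $\mathbf{y}=(y^{(1)},\dots,y^{(r)})$, and let $\boldsymbol{\lambda}=(\lambda^{(1)},\dots,\lambda^{(r)})$ be a sequence of elements of $\mathcal{P}_n$. Write $$s_{\lambda^{(1)}}(x\,|\,y^{(1)})\cdots s_{\lambda^{(r)}}(x\,|\,y^{(r)})=\sum_{\mu\in\mathcal{P}_n}c_{\boldsymbol{\lambda}}^{\mu}(\mathbf{y})\,s_\mu(x),\qquad c_{\boldsymbol{\lambda}}^{\mu}(\mathbf{y})\in\mathbb{Z}[\mathbf{y}].$$ Then for every $\mu\in\mathcal{P}_n$, $$c_{\boldsymbol{\lambda}}^{\mu}(\mathbf{y})=\sum_{T\in\mathcal{LR}_{\boldsymbol{\lambda}}^{\mu}}c_T(\mathbf{y})=\sum_{T\in\mathcal{LR}_{\boldsymbol{\lambda}}^{\mu}}\ \prod_{a\in T,\ a\text{ barred}}y^{(i(a))}_{a+c(a)-r(a)}.$$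
   Context: $\mathcal{P}_n=\{\lambda=(\lambda_1,\dots,\lambda_n)\in\mathbb{N}^n:\lambda_1\ge\dots\ge\lambda_n\}$, identified with Young diagrams (English convention). For $\lambda\in\mathcal{P}_n$, $\mathcal{T}_\lambda$ is the set of semistandard Young tableaux of shape $\lambda$ with entries in $\{1,\dots,n\}$ (rows weakly increasing left to right, columns strictly increasing top to bottom). Let $x=(x_1,\dots,x_n)$ and for $i=1,\dots,r$ let $y^{(i)}=(y^{(i)}_1,y^{(i)}_2,\dots)$ be infinite sets of independent variables. The Schur function is $s_\lambda(x)=\sum_{T\in\mathcal{T}_\lambda}\prod_{a\in T}x_a$, and the factorial Schur function is $s_\lambda(x\,|\,y)=\sum_{T\in\mathcal{T}_\lambda}\prod_{a\in T}(x_a+y_{a+c(a)-r(a)})$, where for an entry $a$ (an integer), $c(a)$ and $r(a)$ are its column and row numbers. The Schur functions $s_\mu(x)$, $\mu\in\mathcal{P}_n$, form a $\mathbb{Z}[\mathbf{y}]$-basis of the ring of polynomials in $x,\mathbf{y}$ symmetric in $x$, so the coefficients $c_{\boldsymbol{\lambda}}^\mu(\mathbf{y})$ are uniquely determined. The skew diagram $\boldsymbol{\lambda}$ is formed by placing the Young diagrams $\lambda^{(1)},\dots,\lambda^{(r)}$ so that each one lies strictly below and strictly to the left of the preceding one (the upper-right corner of $\lambda^{(i+1)}$ touching the lower-left corner of $\lambda^{(i)}$); distinct diagrams thus occupy disjoint rows and disjoint columns. A barred skew tableau of shape $\boldsymbol{\lambda}$ is a filling of the boxes of this skew diagram with elements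 of $\{1,\dots,n\}\cup\{\bar 1,\dots,\bar n\}$ such that, ignoring bars, entries weakly increase along rows from left to right and strictly increase down columns. For an entry $a=j$ or $a=\bar j$, $j$ is its value; in $c_T$ below, ''$a$'' means its value. $i(a)$ is the index of the Young diagram $\lambda^{(i(a))}$ containing $a$, and $c(a),r(a)$ are the column and row numbers of $a$ within that Young diagram. Define $c_T(\mathbf{y})=\prod_{a\in T\text{ barred}}y^{(i(a))}_{a+c(a)-r(a)}$. The unbarred content of $T$ is $\omega(T)=(\xi_1,\dots,\xi_n)$ with $\xi_k$ the number of unbarred entries equal to $k$. The unbarred column word of $T$ is obtained by reading the unbarred entries of each column from top to bottom, starting with the rightmost column and proceeding leftward (barred entries skipped). A word is Yamanouchi if every initial segment contains at least as many $1$'s as $2$'s, at least as many $2$'s as $3$'s, etc. $\mathcal{LR}_{\boldsymbol{\lambda}}^\mu$ is the set of barred skew tableaux of shape $\boldsymbol{\lambda}$ with unbarred content $\mu$ whose unbarred column word is Yamanouchi. *)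

(* Defs.v *)
From HB Require Import structures.
From mathcomp Require Import all_boot all_order all_algebra.
From mathcomp Require Import finmap mpoly.
From mathcomp Require Import -(notations) monalg.

Set Implicit Arguments.
Unset Strict Implicit.
Unset Printing Implicit Defensive.

Import GRing.Theory.
Local Open Scope ring_scope.

(* Everything is 0-based: rows, columns, diagram indices, tableau values
   (elements of 'I_n, where j : 'I_n stands for the value j + 1) and the
   variables y_1, y_2, ... (y k stands for y_{k+1}).  With a = a0 + 1,
   c = c0 + 1 and r = r0 + 1, the variable y_{a+c-r} is then y (a0 + c0 - r0).
   The truncated subtraction on nat is harmless, since an entry in row r of a
   column-strict filling has value at least r. *)

Record npartition (n : nat) := Partition {
  parts :> n.-tuple nat;
  parts_sorted : sorted geq parts
}.
HB.instance Definition _ n := [isSub for @parts n].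
HB.instance Definition _ n := [Choice of npartition n by <:].

Definition box (n : nat) (lam : npartition n) : finType :=
  {i : 'I_n & 'I_(tnth lam i)}.

Definition box_row (n : nat) (lam : npartition n) (b : box lam) : nat := tag b.
Definition box_col (n : nat) (lam : npartition n) (b : box lam) : nat := tagged b.

Definition ssyt (n : nat) (lam : npartition n) : {set {ffun box lam -> 'I_n}} :=
  [set T : {ffun box lam -> 'I_n} | [forall b, forall b',
     ((box_row b == box_row b') && (box_col b <= box_col b')%N ==> (T b <= T b')%N) &&
     ((box_col b == box_col b') && (box_row b < box_row b')%N ==> (T b < T b')%N)]].

Definition schur (n : nat) (R : comNzRingType) (lam : npartition n) :
    {mpoly R[n]} :=
  \sum_(T in ssyt lam) \prod_(b : box lam) 'X_(T b).

Definition factorial_schur (n : nat) (R : comNzRingType) (lam : npartition n)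
    (y : nat -> R) : {mpoly R[n]} :=
  \sum_(T in ssyt lam)
    \prod_(b : box lam) ('X_(T b) + (y (T b + box_col b - box_row b)%N)%:MP).

Definition schur_expansion (n : nat) (R : comNzRingType) (f : {mpoly R[n]})
    (c : {fsfun npartition n -> R with 0}) : Prop :=
  f = \sum_(mu <- finsupp c) c mu *: schur R mu.

(* Free commutative Z-algebra on the set 'I_r * nat of variables. *)
Definition Zy (r : nat) : comNzRingType := malg (cmonom ('I_r * nat)%type) int.

Definition yvar (r : nat) (p : 'I_r) (k : nat) : Zy r :=
  mkmalgU (ucm (p, k)) 1.

Definition skew_box (n r : nat) (lam : 'I_r -> npartition n) : finType :=
  {p : 'I_r & box (lam p)}.

(* Position in the whole skew diagram: the rows of lam p lie below all (nonzero)
   rows of the preceding diagrams, and its columns lie to the right of all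
   columns of the following ones. *)
Definition skew_row (n r : nat) (lam : 'I_r -> npartition n)
    (b : skew_box lam) : nat :=
  ((\sum_(q < r | q < tag b) count (fun k => 0 < k) (lam q)) + box_row (tagged b))%N.
Definition skew_col (n r : nat) (lam : 'I_r -> npartition n)
    (b : skew_box lam) : nat :=
  ((\sum_(q < r | tag b < q) head 0 (lam q)) + box_col (tagged b))%N.

(* An entry (j, bar) has value j and is barred when bar = true. *)
Definition filling (n r : nat) (lam : 'I_r -> npartition n) : finType :=
  {ffun skew_box lam -> 'I_n * bool}.

Definition entry_val (n r : nat) (lam : 'I_r -> npartition n)
    (T : filling lam) (b : skew_box lam) : 'I_n := (T b).1.
Definition barred (n r : nat) (lam : 'I_r -> npartition n)
    (T : filling lam) (b : skew_box lam) : bool := (T b).2.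

Definition barred_skew_tableau (n r : nat) (lam : 'I_r -> npartition n)
    (T : filling lam) : bool :=
  [forall b, forall b',
     ((skew_row b == skew_row b') && (skew_col b <= skew_col b')%N
        ==> (entry_val T b <= entry_val T b')%N) &&
     ((skew_col b == skew_col b') && (skew_row b < skew_row b')%N
        ==> (entry_val T b < entry_val T b')%N)].

Definition unbarred_content (n r : nat) (lam : 'I_r -> npartition n)
    (T : filling lam) : n.-tuple nat :=
  [tuple #|[set b | ~~ barred T b & entry_val T b == k]| | k < n].

Definition column_order (n r : nat) (lam : 'I_r -> npartition n) :
    rel (skew_box lam) :=
  fun b b' => (skew_col b' < skew_col b)%N ||
              (skew_col b == skew_col b') && (skew_row b <= skew_row b')%N.

Definition unbarred_column_word (n r : nat) (lam : 'I_r -> npartition n)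
    (T : filling lam) : seq 'I_n :=
  [seq entry_val T b |
     b <- sort (@column_order n r lam) (enum (skew_box lam)) & ~~ barred T b].

Definition yamanouchi (n : nat) (w : seq 'I_n) : bool :=
  [forall m : 'I_(size w).+1, forall i : 'I_n, forall j : 'I_n,
     (j == i.+1 :> nat) ==>
       (count_mem j (take m w) <= count_mem i (take m w))%N].

Definition LR (n r : nat) (lam : 'I_r -> npartition n) (mu : npartition n) :
    {set filling lam} :=
  [set T : filling lam | [&& barred_skew_tableau T,
     unbarred_content T == mu :> n.-tuple nat &
     yamanouchi (unbarred_column_word T)]].

Definition bar_weight (n r : nat) (lam : 'I_r -> npartition n)
    (T : filling lam) : Zy r :=
  \prod_(b : skew_box lam | barred T b)
    yvar (tag b) (entry_val T b + box_col (tagged b) - box_row (tagged b))%N.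

(* Main.v *)
(** In a row, a maximal run of m entries k, k+1 without a vertical partner has
    a barred or unbarred sum of weights equal to the sum over the position of the
    switch from k to k+1, which is the divided difference of
    t |-> (t + y_0) ... (t + y_m) at x_k, x_(k+1): the index of the missing y is
    the position of the switch.  Hence the generating function of the fillings is
    symmetric, even when the entries in the columns >= j are prescribed, provided
    every k in column j has a k+1 below it.  Multiplying by the alternant of rho
    and antisymmetrizing, as in Stembridge's proof of the Littlewood-Richardson
    rule, the fillings whose column word first violates the Yamanouchi condition
    at column j cancel: the columns >= j contribute, with x^rho, a monomial fixed
    by a transposition, and the columns < j a polynomial with the same symmetry.
    Unbarred fillings of one diagram give a_rho s_mu = a_(rho + mu), so
    coefficients on Schur polynomials are read off after multiplication by
    a_rho. *)

Require Import Defs.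
From mathcomp Require Import all_boot all_order all_algebra all_fingroup.
From mathcomp Require Import finmap mpoly.
From mathcomp Require Import zify ring.

Set Implicit Arguments.
Unset Strict Implicit.
Unset Printing Implicit Defensive.

Import GRing.Theory.
Local Open Scope ring_scope.

(** * Alternants *)

Section Alternant.
Variables (n : nat) (R : comNzRingType).
Implicit Types (p q : {mpoly R[n]}) (m : 'X_{1..n}).

Local Notation "m # s" := [multinom m (s i) | i < n]
  (at level 40, left associativity, format "m # s").

(** Antisymmetrization; the alternant a_m is [alt 'X_[m]]. *)
Definition alt p : {mpoly R[n]} := \sum_(s : 'S_n) (-1) ^+ s *: msym s p.

Lemma alt_sum (I : Type) (r : seq I) (P : pred I) (F : I -> {mpoly R[n]}) :
  alt (\sum_(i <- r | P i) F i) = \sum_(i <- r | P i) alt (F i).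
Proof.
rewrite /alt exchange_big /=; apply: eq_bigr => s _.
by rewrite (raddf_sum (msym s)) scaler_sumr.
Qed.

Lemma altZ c p : alt (c *: p) = c *: alt p.
Proof.
rewrite /alt scaler_sumr; apply: eq_bigr => s _.
by rewrite msymZ !scalerA mulrC.
Qed.

Lemma alt0 : alt 0 = 0.
Proof. by have := altZ 0 0; rewrite !scale0r. Qed.

Lemma altM_sym p q : q \is symmetric -> alt (p * q) = alt p * q.
Proof.
move=> /issymP qs; rewrite /alt mulr_suml; apply: eq_bigr => s _.
by rewrite msymM qs scalerAl.
Qed.

(** Left multiplication by the transposition matches odd with even permutations. It acts on [p]
    first, so matched terms are opposite. *)
Lemma alt_tperm (i j : 'I_n) p :
  i != j -> msym (tperm i j) p = p -> alt p = 0.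
Proof.
move=> ij pij; rewrite /alt (bigID (fun s : 'S_n => odd_perm s)) /=.
rewrite (reindex_inj (mulgI (tperm i j))) /=.
under eq_bigl => s do rewrite odd_permM odd_tperm ij addTb.
rewrite -big_split big1 //= => s even_s.
rewrite odd_permM odd_tperm ij (negbTE even_s) msymMm pij.
by rewrite expr1 scaleN1r scale1r addNr.
Qed.

Definition strictly_decreasing m := forall i j : 'I_n, (i < j)%N -> (m j < m i)%N.

Lemma increasing_perm_ge (s : 'S_n) :
  (forall i j : 'I_n, (i < j)%N -> (s i < s j)%N) -> forall i : 'I_n, (i <= s i)%N.
Proof.
move=> s_inc [i lt_in]; elim: i lt_in => [//|i IHi] lt_in /=.
have lt_in' := ltnW lt_in.
exact: leq_ltn_trans (IHi lt_in') (s_inc (Ordinal lt_in') (Ordinal lt_in) _).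
Qed.

(** Both [s] and its inverse are increasing, hence i <= s i and s i <= i. *)
Lemma strictly_decreasing_perm m (s : 'S_n) :
  strictly_decreasing m -> strictly_decreasing (m#s) -> s = 1%g.
Proof.
move=> dec_m dec_ms.
have s_inc (i j : 'I_n) : (i < j)%N -> (s i < s j)%N.
  move/dec_ms; rewrite !mnmE; apply: contraLR; rewrite -!leqNgt leq_eqVlt.
  by case/predU1P => [/val_inj -> //|/dec_m /ltnW].
have sV_inc (i j : 'I_n) : (i < j)%N -> ((s^-1)%g i < (s^-1)%g j)%N.
  rewrite -{1}[i](permKV s) -{1}[j](permKV s); apply: contraLR.
  rewrite -!leqNgt leq_eqVlt => /predU1P [/val_inj -> //|/s_inc /ltnW //].
apply/permP => i; rewrite perm1; apply/val_inj/eqP; rewrite eqn_leq.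
rewrite increasing_perm_ge // andbT.
by have := increasing_perm_ge sV_inc (s i); rewrite permK.
Qed.

Lemma mcoeff_alt m m' :
  (alt 'X_[m])@_m' = \sum_(s : 'S_n | m#(s^-1)%g == m') (-1) ^+ s.
Proof.
rewrite /alt (raddf_sum (mcoeff m')) [RHS]big_mkcond; apply: eq_bigr => s _ /=.
by rewrite mcoeffZ msymX mcoeffX; case: eqP; rewrite ?mulr1 ?mulr0.
Qed.

Lemma mcoeff_alt_dec m m' : strictly_decreasing m -> strictly_decreasing m' ->
  (alt 'X_[m])@_m' = (m == m')%:R.
Proof.
move=> dec_m dec_m'; rewrite mcoeff_alt.
rewrite (eq_bigl (fun s : 'S_n => (s == 1%g) && (m == m'))).
  case: (m == m'); last by rewrite big_pred0 // => s; rewrite andbF.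
  rewrite (big_pred1 1%g) => [|s]; last by rewrite andbT.
  by rewrite odd_perm1.
move=> s; have m1 : m#(1%g : 'S_n) = m by apply/mnmP => i; rewrite mnmE perm1.
apply/eqP/andP => [mm'|[/eqP -> /eqP <-]]; last by rewrite invg1.
have s1 : s = 1%g.
  by apply: invg_inj; rewrite invg1; apply: (strictly_decreasing_perm dec_m); rewrite mm'.
by move: mm'; rewrite s1 invg1 m1 => ->; rewrite !eqxx.
Qed.

(** [R] may have zero divisors, so regularity comes from the leading coefficient: the exponents in
    [m] are distinct, so a single permutation produces the leading monomial and its coefficient is a
    sign. *)
Lemma lreg_alt m : strictly_decreasing m -> GRing.lreg (alt 'X_[m]).
Proof.
move=> dec_m; apply: lreg_mleadc.
have alt_neq0 : alt 'X_[m] != 0.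
  apply/eqP => alt0; have := mcoeff_alt_dec dec_m dec_m.
  by rewrite alt0 mcoeff0 eqxx => /eqP; rewrite eq_sym oner_eq0.
have := mleadc_eq0 (alt 'X_[m]); rewrite (negbTE alt_neq0).
move: (mlead _) => m' /negbT; rewrite mcoeff_alt => sum_neq0.
case: (pickP (fun s : 'S_n => m#(s^-1)%g == m')) => [s /eqP ms|no_s]; last first.
  by rewrite big_pred0 ?eqxx // in sum_neq0.
rewrite (big_pred1 s) => [|t]; first exact: lreg_sign.
have m_inj : injective m.
  move=> i j mij; apply/val_inj; case: (ltngtP i j) => // /dec_m;
  by rewrite mij ltnn.
rewrite -ms; apply/eqP/eqP => [mst|-> //]; apply/invg_inj/permP => i.
by apply: m_inj; have /mnmP /(_ i) := mst; rewrite !mnmE.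
Qed.

End Alternant.

Definition rho (n : nat) : 'X_{1..n} := [multinom (n - i.+1)%N | i < n].

Lemma rho_add_dec (n : nat) (m : 'X_{1..n}) :
  (forall i j : 'I_n, (i <= j)%N -> (m j <= m i)%N) ->
  strictly_decreasing (rho n + m)%MM.
Proof.
move=> dec_m i j ij; rewrite !mnmDE !mnmE.
by have := dec_m i j (ltnW ij); have := ltn_ord j; lia.
Qed.

(** * Unpaired entries of a skew filling *)

Section RowSum.
Variable A : comNzRingType.
Implicit Types (u v : A) (f : nat -> A).

(** The first [t] boxes of a run hold k, the others k+1. Raising the value by one shifts the index
    of the y variable, hence [f c.+1]. *)
Definition row_sum u v f m : A :=
  \sum_(t < m.+1) \prod_(c < m) (if (c < t)%N then u + f c else v + f c.+1).

Lemma row_sumS u v f m : row_sum u v f m.+1 =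
  \prod_(c < m.+1) (v + f c.+1) + (u + f 0%N) * row_sum u v (f \o succn) m.
Proof.
rewrite {1}/row_sum [LHS]big_ord_recl /=; congr (_ + _).
by rewrite big_distrr; apply: eq_bigr => t _; rewrite big_ord_recl.
Qed.

(* [row_sum] is the divided difference of [fun x => \prod_(c <= m) (x + f c)]. *)
Lemma row_sum_telescope u v f m : (u - v) * row_sum u v f m =
  \prod_(c < m.+1) (u + f c) - \prod_(c < m.+1) (v + f c).
Proof.
elim: m f => [|m IHm] f.
  by rewrite /row_sum !big_ord_recl !big_ord0; ring.
have recl w : \prod_(c < m.+2) (w + f c) =
  (w + f 0%N) * \prod_(c < m.+1) (w + (f \o succn) c) by rewrite big_ord_recl.
rewrite row_sumS mulrDr [in X in _ + X]mulrCA IHm !recl /=.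
by ring.
Qed.

(** Since [u - v] need not be cancellable in [A], the telescoped identity is not divided by it, but
    inserted after one step of the recursion. *)
Lemma row_sumC u v f m : row_sum u v f m = row_sum v u f m.
Proof.
elim: m f => [|m IHm] f; first by rewrite /row_sum !big_ord_recl !big_ord0.
have := row_sum_telescope u v (f \o succn) m; rewrite !row_sumS -IHm /=.
move: (\prod_(_ < _) _) (\prod_(_ < _) _) (row_sum _ _ _ _) => a b c e.
have -> : b = (u - v) * c + a by rewrite e; ring.
by ring.
Qed.
End RowSum.

(** Serves both the product over the boxes of a run and the sum over the positions of its switch. *)
Lemma big_interval (T : Type) (idx : T) (op : Monoid.com_law idx) (I : finType)
    (P : pred I) (x : I -> nat) (lo m : nat) (G : nat -> T) :
  {in P &, injective x} ->
  (forall b, P b -> (lo <= x b < lo + m)%N) ->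
  (forall c : 'I_m, exists2 b, P b & x b = (lo + c)%N) ->
  \big[op/idx]_(b | P b) G (x b) = \big[op/idx]_(c < m) G (lo + c)%N.
Proof.
move=> x_inj x_lt /fin_all_exists2 [h Ph xh].
have h_inj : injective h.
  by move=> c c' hc; apply/val_inj/(@addnI lo); rewrite -!xh hc.
rewrite (eq_bigl (mem (h @: 'I_m))); last first.
  move=> b; apply/idP/imsetP => [Pb|[c _ ->]]; last exact: Ph.
  have /andP[lo_le lt_m] := x_lt b Pb.
  have lt : (x b - lo < m)%N by lia.
  exists (Ordinal lt) => //; apply: x_inj; [exact: Pb | exact: Ph |].
  by rewrite xh /=; lia.
rewrite big_imset /=; last by move=> ? ? _ _; apply: h_inj.
by apply: eq_bigr => c _; rewrite xh.
Qed.

Section MsymVar.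
Variables (n : nat) (R : comNzRingType) (s : 'S_n).

Lemma msym_var i : msym s ('X_i : {mpoly R[n]}) = 'X_(s i).
Proof. by rewrite /msym mmapX mmap1U. Qed.

Lemma msym_const (c : R) : msym s c%:MP_[n] = c%:MP_[n].
Proof. by rewrite /msym mmapC. Qed.
End MsymVar.

(** * Bender-Knuth pairing of k and k+1 in a skew shape *)

Section Shape.
Variables (n : nat) (B : finType) (row col : B -> nat).

(** Abstract in the positions, to cover both a single Young diagram and the skew diagram. *)
Definition semistandard (V : B -> 'I_n) : bool :=
  [forall b, forall b',
     ((row b == row b') && (col b <= col b')%N ==> (V b <= V b')%N) &&
     ((col b == col b') && (row b < row b')%N ==> (V b < V b')%N)].

Lemma semistandardP (V : B -> 'I_n) : reflect
  ((forall b b', row b = row b' -> (col b <= col b')%N -> (V b <= V b')%N) /\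
   (forall b b', col b = col b' -> (row b < row b')%N -> (V b < V b')%N))
  (semistandard V).
Proof.
apply: (iffP forallP) => [ssV|[rowV colV] b].
  by split=> b b' /eqP e l; have /forallP/(_ b') := ssV b; rewrite e l /=
    => /andP[].
by apply/forallP => b'; apply/andP; split; apply/implyP => /andP[/eqP e l];
  [apply: rowV | apply: colV].
Qed.

(** Characterizes skew shapes among finite sets of positions. *)
Hypothesis convex : forall b b' i c, (row b <= i <= row b')%N ->
  (col b <= c <= col b')%N -> exists2 d, row d = i & col d = c.

Section Swap.
Variables (k j : nat).
Implicit Types (F V : B -> 'I_n) (b d : B).

Definition partner V b b' := (col b == col b') &&
  ([&& row b' == (row b).+1, V b == k :> nat & V b' == k.+1 :> nat] ||
   [&& row b == (row b').+1, V b == k.+1 :> nat & V b' == k :> nat]).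

Definition unpaired V b :=
  [&& (col b < j)%N, (V b == k :> nat) || (V b == k.+1 :> nat) &
      ~~ [exists b', partner V b b']].

(* Keeps an unpaired entry of a column [< j] from being blocked on its right by an
   equal entry of column [j], so that it may be changed from [k] to [k.+1]. *)
Definition supported V := forall b, col b = j -> V b = k :> nat ->
  exists2 b', partner V b b' & row b' = (row b).+1.

Lemma partnerC V b b' : partner V b b' = partner V b' b.
Proof. by rewrite /partner; lia. Qed.

Lemma unpaired_val V b : unpaired V b -> (V b = k :> nat \/ V b = k.+1 :> nat).
Proof. by case/and3P => _ /orP[] /eqP; [left | right]. Qed.

Lemma unpaired_partner V b b' : unpaired V b -> ~~ partner V b b'.
Proof. by case/and3P => _ _; apply: contra => p; apply/existsP; exists b'. Qed.

(** No value lies strictly between k and k+1, so a k above an unpaired k+1 would be adjacent to it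
    and be its partner. *)
Lemma unpaired_above F b b' : semistandard F -> unpaired F b ->
  col b' = col b -> (row b' < row b)%N -> (F b' < k)%N.
Proof.
move=> /semistandardP[_ colF] Fb eqc ltr.
have := colF _ _ eqc ltr; have := unpaired_partner b' Fb; rewrite /partner eqc eqxx.
case: (unpaired_val Fb) => Fk; first by rewrite Fk.
rewrite Fk ltnS => /= npart le_k.
rewrite ltn_neqAle le_k andbT; apply: contra npart => /eqP F'k.
rewrite F'k !eqxx !andbT orbC; case: eqP => //= ner.
have [||d rd cd] := convex (b := b') (b' := b) (i := (row b').+1) (c := col b).
- by lia.
- by rewrite eqc leqnn.
have := colF b' d; have := colF d b; rewrite rd cd => /(_ erefl) h1 h2.
have {}h1 := h1 ltac:(lia); have {}h2 := h2 eqc ltac:(lia).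
by lia.
Qed.

Lemma unpaired_below F b b' : semistandard F -> unpaired F b ->
  col b' = col b -> (row b < row b')%N -> (k.+1 < F b')%N.
Proof.
move=> /semistandardP[_ colF] Fb eqc ltr.
have := colF _ _ (esym eqc) ltr; have := unpaired_partner b' Fb.
rewrite /partner eqc eqxx.
case: (unpaired_val Fb) => Fk; last by rewrite Fk.
rewrite Fk => /= npart le_k.
rewrite ltn_neqAle le_k andbT; apply: contra npart => /eqP F'k.
rewrite -F'k !eqxx !andbT; case: eqP => //= ner.
have [||d rd cd] := convex (b := b) (b' := b') (i := (row b).+1) (c := col b).
- by lia.
- by rewrite eqc leqnn.
have := colF b d; have := colF d b'; rewrite rd cd => h1 /(_ erefl) h2.
have {}h1 := h1 (esym eqc) ltac:(lia); have {}h2 := h2 ltac:(lia).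
by lia.
Qed.

(** A paired k+1 on the left has a k above it; by convexity there is then a box above [b] with entry
    at least k, against [unpaired_above]. *)
Lemma unpaired_left F b b' : semistandard F -> unpaired F b -> ~~ unpaired F b' ->
  row b' = row b -> (col b' <= col b)%N -> (F b' <= k)%N.
Proof.
move=> ssF Fb nF eqr lec; have /semistandardP[rowF colF] := ssF.
rewrite leqNgt; apply: contra nF => lt_k.
have ltj : (col b < j)%N by case/and3P: Fb.
have lebb := rowF _ _ eqr lec.
have [F'k Fk] : F b' = k.+1 :> nat /\ F b = k.+1 :> nat.
  by case: (unpaired_val Fb); lia.
apply/and3P; split; [by lia | by rewrite F'k eqxx orbT |].
apply/existsP => -[a /andP[/eqP eqc]]; rewrite F'k.
have /negbTE-> : k.+1 != k by lia.
rewrite andbF eqxx /= => /andP[/eqP ra /eqP Fa].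
have [||d rd cd] := convex (b := a) (b' := b) (i := row a) (c := col b).
- by lia.
- by lia.
have := rowF a d; have := unpaired_above (b' := d) ssF Fb cd.
by rewrite rd cd => h1 /(_ erefl); lia.
Qed.

Lemma unpaired_right F b b' : semistandard F -> supported F -> unpaired F b ->
  ~~ unpaired F b' -> row b' = row b -> (col b <= col b')%N -> (k < F b')%N.
Proof.
move=> ssF supF Fb nF eqr lec; have /semistandardP[rowF colF] := ssF.
rewrite ltnNge; apply: contra nF => le_k.
have lebb := rowF _ _ (esym eqr) lec.
have [F'k Fk] : F b' = k :> nat /\ F b = k :> nat.
  by case: (unpaired_val Fb); lia.
have no_below a : row a = (row b).+1 -> (col b <= col a)%N ->
    F a = k.+1 :> nat -> False.
  move=> ra lca Fa.
  have [||d rd cd] := convex (b := b) (b' := a) (i := row a) (c := col b).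
  - by lia.
  - by lia.
  have := rowF d a; have := unpaired_below (b' := d) ssF Fb cd.
  by rewrite rd cd => h1 /(_ erefl); lia.
(* Otherwise the row has a k in column [j]; the k+1 that [supported] puts below it is excluded by
   [no_below]. *)
have ltj : (col b' < j)%N.
  rewrite ltnNge; apply/negP => lej.
  have [||d rd cd] := convex (b := b) (b' := b') (i := row b) (c := j).
  - by lia.
  - by case/and3P: Fb; lia.
  have Fd : F d = k :> nat.
    have := rowF b d; have := rowF d b'.
    by rewrite rd cd => h1 h2; have := h1 (esym eqr) lej; have := h2 erefl;
      case/and3P: Fb; lia.
  have [a] := supF d cd Fd; rewrite /partner => /andP[/eqP ca pa] ra.
  have := no_below a; rewrite ra rd -ca cd => /(_ erefl); case/and3P: Fb => ltj _ _.
  by move: pa; lia.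
apply/and3P; split; [by [] | by rewrite F'k eqxx |].
apply/existsP => -[a /andP[/eqP eqc pa]].
by apply: (no_below a); move: pa; lia.
Qed.

(** Entries above and to the left of unpaired ones are small enough, those below and to the right
    large enough, for either value k or k+1. No partner is created or lost, because an unpaired
    entry has neither k nor k+1 elsewhere in its column. *)
Lemma switch F V : semistandard F -> supported F ->
  (forall b, ~~ unpaired F b -> V b = F b) ->
  (forall b, unpaired F b -> V b = k :> nat \/ V b = k.+1 :> nat) ->
  (forall b b', unpaired F b -> unpaired F b' -> row b = row b' ->
     (col b <= col b')%N -> (V b <= V b')%N) ->
  semistandard V /\ unpaired V =1 unpaired F.
Proof.
move=> ssF supF offF onF monoF; have /semistandardP[rowF colF] := ssF.
split.
  apply/semistandardP; split=> b b' e l.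
    case: (boolP (unpaired F b)) => Fb; case: (boolP (unpaired F b')) => Fb'.
    - exact: monoF.
    - rewrite (offF _ Fb'); have := unpaired_right ssF supF Fb Fb' (esym e) l.
      by case: (onF b Fb) => ->; lia.
    - rewrite (offF _ Fb); have := unpaired_left ssF Fb' Fb e l.
      by case: (onF b' Fb') => ->; lia.
    - by rewrite !offF // rowF.
  case: (boolP (unpaired F b)) => Fb; last first.
    rewrite (offF _ Fb); case: (boolP (unpaired F b')) => Fb'; last first.
      by rewrite (offF _ Fb') colF.
    by have := unpaired_above ssF Fb' e l; case: (onF b' Fb') => ->; lia.
  have lt_F := unpaired_below ssF Fb (esym e) l.
  rewrite (offF b'); first by case: (onF b Fb) => ->; lia.
  by apply/negP => /unpaired_val; lia.
move=> b; apply/idP/idP => [Vb|Fb]; last first.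
  have /and3P[ltj _ _] := Fb.
  apply/and3P; split=> //; first by case: (onF b Fb) => ->; rewrite eqxx ?orbT.
  apply/existsP => -[b' /andP[/eqP eqc p]].
  have nF : ~~ unpaired F b'.
    apply/negP => /unpaired_val vF.
    have := unpaired_below ssF Fb (esym eqc); have := unpaired_above ssF Fb (esym eqc).
    by move: p; lia.
  move: p; rewrite (offF _ nF).
  have := unpaired_below ssF Fb (esym eqc); have := unpaired_above ssF Fb (esym eqc).
  by lia.
apply: contraLR Vb => nF; have eV := offF _ nF.
move: nF; rewrite /unpaired eV; case: (_ < _)%N => //=; case: (_ || _) => //=.
rewrite !negbK => /existsP[b' p]; apply/existsP; exists b'; move: (p).
rewrite /partner eV offF //; apply/negP => /and3P[_ _ /negP]; apply.
by apply/existsP; exists b; rewrite partnerC.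
Qed.

(** Between two unpaired boxes of a row, any other box would have an entry both at most k and
    greater than k. *)
Lemma unpaired_interval F i : semistandard F -> supported F -> exists lo m,
  [/\ (forall b, unpaired F b -> row b = i -> (lo <= col b < lo + m)%N),
      (forall c : 'I_m, exists2 b, unpaired F b && (row b == i) & col b = (lo + c)%N) &
      (lo + m <= (\max_b col b).+1)%N].
Proof.
move=> ssF supF.
case: (pickP (fun b => unpaired F b && (row b == i))) => [b0 Pb0|no_b]; last first.
  exists 0%N, 0%N; split=> //; last by case.
  by move=> b Fb rb; have := no_b b; rewrite Fb rb eqxx.
case: (@arg_minnP _ b0 (fun b => unpaired F b && (row b == i)) col Pb0)
  => b1 /andP[F1 /eqP r1] min1.
case: (@arg_maxnP _ b0 (fun b => unpaired F b && (row b == i)) col Pb0)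
  => b2 /andP[F2 /eqP r2] max2.
exists (col b1), ((col b2).+1 - col b1)%N.
have le12 := min1 b2; rewrite F2 r2 eqxx in le12.
have {}le12 := le12 isT.
split.
- move=> b Fb /eqP rb; have := min1 b; have := max2 b; rewrite Fb rb.
  by move=> /(_ isT) h1 /(_ isT) h2; lia.
- move=> c.
  have [||d rd cd] := convex (b := b1) (b' := b2) (i := i) (c := (col b1 + c)%N).
  + by rewrite r1 r2 leqnn.
  + by have := ltn_ord c; lia.
  exists d => //; rewrite rd eqxx andbT; apply/negPn/negP => nF.
  have := unpaired_left ssF F2 nF; have := unpaired_right ssF supF F1 nF.
  by rewrite rd r1 r2 cd; have := ltn_ord c; lia.
- by rewrite subnKC ?ltnS ?leq_bigmax // ltnW.
Qed.

End Swap.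
End Shape.

(** * Symmetry under a transposition *)

Section SwapSymmetry.
Variables (n : nat) (R : comNzRingType) (B : finType) (row col : B -> nat).
Hypothesis pos_inj : forall b b', row b = row b' -> col b = col b' -> b = b'.
Hypothesis convex : forall b b' i c, (row b <= i <= row b')%N ->
  (col b <= c <= col b')%N -> exists2 d, row d = i & col d = c.
(** Abstract form of the variables y_{a+c-r}: in a row only a + c matters, and one row down the
    value increased by one has the same variable. *)
Variables (W : B -> nat -> R) (Z : nat -> nat -> R).
Hypothesis W_row : forall b v, W b v = Z (row b) (v + col b).
Hypothesis W_below : forall b b' v, col b' = col b -> row b' = (row b).+1 ->
  W b' v.+1 = W b v.
Variables (k0 k1 : 'I_n) (j : nat).
Hypothesis k01 : k1 = k0.+1 :> nat.
Implicit Types (F V : B -> 'I_n) (b : B).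

Local Notation semistandard := (semistandard row col).
Local Notation partner := (partner row col k0).
Local Notation unpaired := (unpaired row col k0 j).
Local Notation supported := (supported row col k0 j).
Local Notation swap := (tperm k0 k1).

Definition box_factor b (v : 'I_n) : {mpoly R[n]} := 'X_v + (W b v)%:MP.

Lemma msym_box_factor (s : 'S_n) b v :
  msym s (box_factor b v) = 'X_(s v) + (W b v)%:MP.
Proof. by rewrite /box_factor msymD msym_var msym_const. Qed.

Let val_k0 (v : 'I_n) : (v == k0 :> nat) = (v == k0). Proof. by []. Qed.
Let val_k1 (v : 'I_n) : (v == k0.+1 :> nat) = (v == k1).
Proof. by rewrite -k01. Qed.

Definition mate F b := odflt b [pick b' | partner F b b'].

Lemma partner_uniq F b b1 b2 : partner F b b1 -> partner F b b2 -> b1 = b2.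
Proof. by rewrite /partner => p1 p2; apply: pos_inj; lia. Qed.

Lemma mateP F b b' : partner F b b' -> mate F b = b'.
Proof.
rewrite /mate => p; case: pickP => [b'' p'|/(_ b')]; last by rewrite p.
exact: partner_uniq p' p.
Qed.

Lemma mateK F : involutive (mate F).
Proof.
move=> b; case: (pickP (partner F b)) => [b' p|no_p].
  by rewrite (mateP p); apply: mateP; rewrite partnerC.
have e : mate F b = b by rewrite /mate; case: pickP => // b'; rewrite no_p.
by rewrite !e.
Qed.

(** The two boxes of a vertical pair carry x_k + y and x_(k+1) + y with the same y, by [W_below];
    the transposition exchanges these factors, and reindexing by [mate] undoes the exchange. *)
Lemma msym_paired F (P := fun b => (col b < j)%N && ~~ unpaired F b) :
  msym swap (\prod_(b | P b) box_factor b (F b)) =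
  \prod_(b | P b) box_factor b (F b).
Proof.
rewrite rmorph_prod /= (reindex_inj (inv_inj (mateK F))) /=.
have mate_cases b : (exists2 b', partner F b b' & mate F b = b') \/
    mate F b = b /\ (forall b', ~~ partner F b b').
  case: (pickP (partner F b)) => [b' p|no_p]; [left | right].
    by exists b' => //; apply: mateP.
  split=> [|b']; last by rewrite no_p.
  by rewrite /mate; case: pickP => // b'; rewrite no_p.
have P_mate b : P (mate F b) = P b.
  case: (mate_cases b) => [[b' p ->]|[-> //]].
  have ex b1 b2 : partner F b1 b2 -> ~~ unpaired F b1.
    move=> p12; apply/negP => /and3P[_ _ /negP]; apply.
    by apply/existsP; exists b2.
  rewrite /P (ex _ _ p) (ex b' b) 1?partnerC // !andbT.
  by case/andP: p => /eqP ->.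
under eq_bigl => b do rewrite P_mate.
apply: eq_bigr => b /andP[ltj nF]; rewrite msym_box_factor.
case: (mate_cases b) => [[b' /andP[/eqP eqc p] ->]|[-> no_p]].
  case/orP: p => /and3P[/eqP r /eqP Fb /eqP Fb'].
    have -> : F b = k0 by apply/val_inj.
    have -> : F b' = k1 by apply/val_inj; rewrite /= Fb'.
    by rewrite tpermR /box_factor k01 (W_below _ (esym eqc) r).
  have -> : F b = k1 by apply/val_inj; rewrite /= Fb.
  have -> : F b' = k0 by apply/val_inj.
  by rewrite tpermL /box_factor k01 (W_below _ eqc r).
rewrite tpermD // eq_sym; apply: contra nF => Fb; apply/and3P; split=> //.
- by rewrite val_k0 Fb.
- by apply/existsP => -[b' p]; have := no_p b'; rewrite p.
- by rewrite val_k1 Fb orbT.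
- by apply/existsP => -[b' p]; have := no_p b'; rewrite p.
Qed.

(** Exceeds every row and every switch position, so that ['I_M] indexes both. *)
Let M := (\max_b row b + (\max_b col b).+1).+1%N.

(** The sum is a [row_sum] in x_k and x_(k+1), which the transposition exchanges; [row_sumC]
    concludes. *)
Lemma msym_unpaired_row F i lo m :
  (forall b, unpaired F b -> row b = i -> (lo <= col b < lo + m)%N) ->
  (forall c : 'I_m, exists2 b, unpaired F b && (row b == i) & col b = (lo + c)%N) ->
  (lo + m < M)%N ->
  let p := \sum_(t < M | (lo <= t < lo + m.+1)%N)
    \prod_(b | unpaired F b && (row b == i))
      box_factor b (if (col b < t)%N then k0 else k1) in
  msym swap p = p.
Proof.
move=> col_lt col_onto ltM /=.
set p := \sum_(_ < _ | _) _.
have -> : p = row_sum 'X_k0 'X_k1 (fun c => (Z i (k0 + (lo + c)))%:MP) m.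
  rewrite /p (@big_interval _ _ _ _ _ (fun t : 'I_M => t : nat) lo m.+1 (fun t =>
    \prod_(b | unpaired F b && (row b == i))
      box_factor b (if (col b < t)%N then k0 else k1))) //; first last.
  - move=> c; have lt : (lo + c < M)%N by have := ltn_ord c; lia.
    by exists (Ordinal lt) => //=; have := ltn_ord c; lia.
  - by move=> t t' _ _ /val_inj.
  apply: eq_bigr => t _.
  (* The value k+1 in column c has the variable of the value k in column c+1. *)
  pose G c : {mpoly R[n]} := if (c < lo + t)%N then 'X_k0 + (Z i (k0 + c))%:MP
    else 'X_k1 + (Z i (k0 + c.+1))%:MP.
  rewrite (eq_bigr (G \o col)); last first.
    move=> b /andP[_ /eqP rb]; rewrite /G /box_factor /= !W_row rb.
    by case: ifP; rewrite ?k01 ?addSnnS.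
  rewrite (@big_interval _ _ _ _ _ col lo m G) //.
  - by apply: eq_bigr => c _; rewrite /G ltn_add2l !addnS.
  - by move=> b b' /andP[_ /eqP r] /andP[_ /eqP r'] e; apply: pos_inj; rewrite ?r.
  - by move=> b /andP[Fb /eqP rb]; apply: col_lt.
rewrite [RHS]row_sumC /row_sum raddf_sum; apply: eq_bigr => t _ /=.
rewrite rmorph_prod; apply: eq_bigr => c _ /=.
by case: ifP => _; rewrite msymD msym_var msym_const ?tpermL ?tpermR.
Qed.

(* [collapse] is constant on the classes of fillings over which the sum is
   symmetric: a class is parametrized by one threshold per row. *)
Definition collapse V : {ffun B -> 'I_n} :=
  [ffun b => if unpaired V b then k0 else V b].

Let row_ord b : 'I_M := inord (row b).

Let row_ordK b : row_ord b = row b :> nat.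
Proof. by rewrite inordK // ltnS (leq_trans (leq_bigmax b)) ?leq_addr. Qed.

Let ltM c : (c <= (\max_b col b).+1)%N -> (c < M)%N.
Proof. by rewrite ltnS => le; rewrite (leq_trans le) ?leq_addl. Qed.

(** * Fillings that differ only in the switch positions of their unpaired runs *)

Section Class.
Variable F : B -> 'I_n.
Hypotheses (ssF : semistandard F) (supF : supported F).

Definition threshold_filling (t : {ffun 'I_M -> 'I_M}) : {ffun B -> 'I_n} :=
  [ffun b => if unpaired F b then if (col b < t (row_ord b))%N then k0 else k1
             else F b].

Let threshold_switch t : semistandard (threshold_filling t) /\
  unpaired (threshold_filling t) =1 unpaired F.
Proof.
apply: (switch convex) => // [b nF|b Fb|b b' Fb Fb' e l].
- by rewrite ffunE (negbTE nF).
- by rewrite ffunE Fb; case: ifP; rewrite ?k01; [left | right].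
- have e' : row_ord b = row_ord b' by apply/val_inj; rewrite /= !row_ordK.
  by rewrite !ffunE Fb Fb' e'; do 2!case: ifP => //; rewrite ?k01; lia.
Qed.

Lemma semistandard_threshold t : semistandard (threshold_filling t).
Proof. by case: (threshold_switch t). Qed.

Lemma collapse_threshold t : collapse (threshold_filling t) = collapse F.
Proof.
have [_ unpaired_eq] := threshold_switch t.
by apply/ffunP => b; rewrite !ffunE unpaired_eq; case: (unpaired F b).
Qed.

Lemma collapse_switch V : semistandard V -> supported V ->
  semistandard (collapse V) /\ unpaired (collapse V) =1 unpaired V.
Proof.
move=> ssV supV; apply: (switch convex) => // [b nF|b Fb|b b' Fb Fb' e l].
- by rewrite ffunE (negbTE nF).
- by left; rewrite ffunE Fb.
- by rewrite !ffunE Fb Fb'.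
Qed.

(** Collapsing leaves the unpaired boxes in place, so they can be read off the common collapse. *)
Lemma collapse_eq V : semistandard V -> supported V ->
  collapse V = collapse F -> unpaired V =1 unpaired F.
Proof.
move=> ssV supV e b; have [_ <-] := collapse_switch ssV supV.
by rewrite e; have [_ ->] := collapse_switch ssF supF.
Qed.

Variables (lo m : 'I_M -> nat).
Hypothesis col_lt : forall (i : 'I_M) b, unpaired F b -> row b = i ->
  (lo i <= col b < lo i + m i)%N.
Hypothesis col_onto : forall (i : 'I_M) (c : 'I_(m i)),
  exists2 b, unpaired F b && (row b == i) & col b = (lo i + c)%N.
Hypothesis lo_lt : forall i, (lo i + m i < M)%N.

(** Both ends of the range are included: a run of [m i] boxes has [(m i).+1] fillings. A row without
    unpaired boxes has [m i = 0] and a single threshold, so each filling is counted once. *)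
Definition thresholds : pred {ffun 'I_M -> 'I_M} :=
  family (fun i => [pred t : 'I_M | (lo i <= t < lo i + (m i).+1)%N]).

Lemma threshold_inj : {in thresholds &, injective threshold_filling}.
Proof.
suff lt_neq t t' i : t \in thresholds -> t' \in thresholds ->
    (t i < t' i)%N -> threshold_filling t <> threshold_filling t'.
  move=> t t' tT t'T e; apply/ffunP => i; apply/val_inj.
  case: (ltngtP (t i) (t' i)) => // [/lt_neq|/lt_neq]; first by case.
  by move/(_ t'T tT); rewrite e.
move=> /familyP/(_ i); rewrite inE /= => t_i /familyP/(_ i); rewrite inE /= => t'_i lt.
(* The unpaired box in column [t i] holds k+1 for [t] and k for [t']. *)
have lt_m : (t i - lo i < m i)%N by lia.
have [b /andP[Fb /eqP rb] cb] := col_onto (Ordinal lt_m).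
have ri : row_ord b = i by apply/val_inj; rewrite /= row_ordK rb.
move=> /ffunP/(_ b); rewrite !ffunE Fb ri cb /= => /(congr1 val) /=.
have -> : (lo i + (t i - lo i) < t i)%N = false by lia.
have -> : (lo i + (t i - lo i) < t' i)%N by lia.
by rewrite k01; lia.
Qed.

Lemma threshold_surj V : semistandard V -> supported V ->
  collapse V = collapse F ->
  exists2 t, t \in thresholds & threshold_filling t =1 V.
Proof.
move=> ssV supV e; have unpairedV := collapse_eq ssV supV e.
have [rowV _] := semistandardP _ _ _ ssV.
have ex i : exists2 t : 'I_M, (lo i <= t < lo i + (m i).+1)%N &
    forall b, unpaired F b -> row b = i -> (V b == k0) = (col b < t)%N.
  (* The threshold is the least column from which on all unpaired boxes of the row hold k+1. *)
  pose Q c := (lo i <= c)%N && [forall b, [&& unpaired F b, row b == i & (c <= col b)%N]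
                                ==> (V b == k1)].
  have Qmax : Q (lo i + m i)%N.
    rewrite /Q leq_addr; apply/forallP => b; apply/implyP => /and3P[Fb /eqP rb].
    by have := col_lt Fb rb; lia.
  have exQ : exists c, Q c by exists (lo i + m i)%N.
  case: (ex_minnP exQ) => c /andP[le_c /forallP Qc] minc.
  have ltcM : (c < M)%N by apply: leq_ltn_trans (lo_lt i); apply: minc.
  exists (Ordinal ltcM) => /= [|b Fb rb].
    by rewrite le_c addnS ltnS minc.
  have := unpaired_val (etrans (unpairedV b) Fb).
  case: (leqP c (col b)) => lt_c vV.
    have := Qc b; rewrite Fb rb eqxx lt_c /= => /eqP ->.
    by apply/eqP => /(congr1 val); rewrite /= k01; lia.
  apply/eqP/val_inj; case: vV => // Vb /=.
  (* A k+1 in [b] would spread to the right along the row and contradict the minimality of [c]. *)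
  have : Q (col b).
    rewrite /Q; have /andP[-> _] /= := col_lt Fb rb; apply/forallP => b'.
    apply/implyP => /and3P[Fb' /eqP rb' le]; apply/eqP/val_inj => /=.
    have := rowV b b'; rewrite rb rb' => /(_ erefl le).
    by rewrite k01; case: (unpaired_val (etrans (unpairedV b') Fb')); lia.
  by move/minc; lia.
have [t t_in tV] := fin_all_exists2 ex.
exists (finfun t); first by apply/familyP => i; rewrite inE ffunE; apply: t_in.
move=> b; rewrite ffunE; case: ifP => Fb; last first.
  by have /ffunP/(_ b) := e; rewrite !ffunE unpairedV Fb.
rewrite ffunE -tV ?row_ordK //.
case: eqP => [-> //|neq].
case: (unpaired_val (etrans (unpairedV b) Fb)) => vV.
  by case: neq; apply/val_inj.
by apply/val_inj; rewrite /= k01.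
Qed.

End Class.

Definition agrees (V0 : B -> 'I_n) V := [forall b, (j <= col b)%N ==> (V b == V0 b)].

Lemma agrees_supported V0 V : supported V0 -> agrees V0 V -> supported V.
Proof.
move=> supV0 /forallP ag b cb; have {}ag b' : col b' = j -> V b' = V0 b'.
  by move=> cb'; apply/eqP; move: (ag b'); rewrite cb' leqnn.
rewrite (ag b cb) => /(supV0 b cb)[b' p r]; exists b' => //.
move: (p); rewrite /partner; case/andP => /eqP cbb' _.
by move: p; rewrite /partner !ag // -cbb'.
Qed.

(** Grouped by [collapse], each class contributes the paired part times one sum over thresholds per
    row, and all these factors are invariant. *)
Lemma msym_swap V0 : supported V0 ->
  let p := \sum_(V : {ffun B -> 'I_n} | semistandard V && agrees V0 V)
             \prod_(b | (col b < j)%N) box_factor b (V b) in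
  msym swap p = p.
Proof.
move=> supV0 /=.
pose P (V : {ffun B -> 'I_n}) := semistandard V && agrees V0 V.
rewrite (partition_big (fun V : {ffun B -> 'I_n} => collapse V) xpredT) //=.
rewrite raddf_sum; apply: eq_bigr => K _ /=.
case: (pickP (fun V : {ffun B -> 'I_n} => P V && (collapse V == K))) => [F|no_F];
  last by rewrite big_pred0 ?msym0.
case/andP => /andP[ssF agF] /eqP <-{K}; have supF := agrees_supported supV0 agF.
have /fin_all_exists [lo /fin_all_exists [m lom]] :
  forall i : 'I_M, exists lo m,
    [/\ (forall b, unpaired F b -> row b = i -> (lo <= col b < lo + m)%N),
      (forall c : 'I_m, exists2 b, unpaired F b && (row b == i) & col b = (lo + c)%N) &
      (lo + m <= (\max_b col b).+1)%N].
  by move=> i; apply: unpaired_interval.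
have col_lt (i : 'I_M) b : unpaired F b -> row b = i -> (lo i <= col b < lo i + m i)%N.
  by case: (lom i) => h _ _; apply: h.
have col_onto (i : 'I_M) (c : 'I_(m i)) :
    exists2 b, unpaired F b && (row b == i) & col b = (lo i + c)%N.
  by case: (lom i).
have lo_lt i : (lo i + m i < M)%N by case: (lom i) => _ _ /ltM.
rewrite (eq_bigl (mem (threshold_filling F @: thresholds lo m))); last first.
  move=> V; apply/idP/imsetP => [/andP[/andP[ssV agV] /eqP e]|[t tT ->]].
    have supV := agrees_supported supV0 agV.
    have [t tT tV] := threshold_surj ssF supF col_lt lo_lt ssV supV e.
    by exists t => //; apply/ffunP => b; rewrite tV.
  rewrite semistandard_threshold // collapse_threshold // eqxx andbT /=.
  apply/forallP => b; apply/implyP => le_j; rewrite ffunE.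
  rewrite ifN; first by have /forallP/(_ b) := agF; rewrite le_j.
  by apply/negP => /and3P[]; rewrite ltnNge le_j.
rewrite big_imset /=; last exact: threshold_inj.
pose Q b := (col b < j)%N && ~~ unpaired F b.
rewrite (eq_bigr (fun t : {ffun 'I_M -> 'I_M} => \prod_(b | Q b) box_factor b (F b) *
  \prod_(i < M) \prod_(b | unpaired F b && (row b == i))
    box_factor b (if (col b < t i)%N then k0 else k1))); last first.
  move=> t _; rewrite [LHS](bigID (fun b => unpaired F b)) [LHS]mulrC /=; congr (_ * _).
    by apply: eq_bigr => b /andP[_ /negbTE nF]; rewrite ffunE nF.
  rewrite (eq_bigl (fun b => unpaired F b)); last first.
    by move=> b; rewrite andb_idl // => /and3P[].
  rewrite (partition_big row_ord xpredT) //=; apply: eq_bigr => i _.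
  apply: eq_big => [b|b /andP[Fb /eqP <-]]; last by rewrite ffunE Fb.
  by rewrite -val_eqE /= row_ordK.
(* Distributivity: the rows choose their thresholds independently. *)
rewrite -big_distrr -(bigA_distr_big_dep _ (fun (i t : 'I_M) =>
  \prod_(b | unpaired F b && (row b == i))
    box_factor b (if (col b < t)%N then k0 else k1))).
rewrite msymM msym_paired; congr (_ * _).
rewrite (rmorph_prod (msym swap)); apply: eq_bigr => i _ /=.
by apply: msym_unpaired_row => // b; apply: col_lt.
Qed.

End SwapSymmetry.

(** * Cancellation *)

(** Every transposition is obtained from adjacent ones by conjugation, by induction on the distance,
    and transpositions generate the group. *)
Lemma adjacent_symmetric (n : nat) (R : comNzRingType) (p : {mpoly R[n]}) :
  (forall i j : 'I_n, j = i.+1 :> nat -> msym (tperm i j) p = p) ->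
  p \is symmetric.
Proof.
move=> adj; have tp d (i j : 'I_n) : j = (i + d).+1 :> nat -> msym (tperm i j) p = p.
  elim: d j => [|d IHd] j ej; first by apply: adj; rewrite ej addn0.
  have lt : ((i + d).+1 < n)%N by have := ltn_ord j; lia.
  pose j' := Ordinal lt; have jj' : msym (tperm j' j) p = p.
    by apply: adj; rewrite ej /= addnS.
  have -> : tperm i j = (tperm i j' ^ tperm j' j)%g.
    by rewrite tpermJ tpermL tpermD // -val_eqE /= ?ej; lia.
  by rewrite conjgE tpermV !msymMm jj' (IHd j') // jj'.
apply/issymP => s; have [ts -> _] := prod_tpermP s.
elim: ts => [|[i j] ts IHts]; first by rewrite big_nil msym1m.
rewrite big_cons msymMm /=; have -> // : msym (tperm i j) p = p.
case: (ltngtP i j) => [lt|lt|/val_inj ->]; last by rewrite tperm1 msym1m.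
  by apply: (tp (j - i).-1); lia.
by rewrite tpermC; apply: (tp (i - j).-1); lia.
Qed.

Section Cancellation.
Variables (n : nat) (R : comNzRingType) (B : finType) (row col : B -> nat).
Hypothesis pos_inj : forall b b', row b = row b' -> col b = col b' -> b = b'.
Hypothesis convex : forall b b' i c, (row b <= i <= row b')%N ->
  (col b <= c <= col b')%N -> exists2 d, row d = i & col d = c.
Variables (W : B -> nat -> R) (Z : nat -> nat -> R).
Hypothesis W_row : forall b v, W b v = Z (row b) (v + col b).
Hypothesis W_below : forall b b' v, col b' = col b -> row b' = (row b).+1 ->
  W b' v.+1 = W b v.
Implicit Types (T : {ffun B -> 'I_n * bool}) (V : {ffun B -> 'I_n}).

Local Notation semistandard := (semistandard row col).
Local Notation box_factor := (box_factor W).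

Lemma symmetric_sum_fillings :
  \sum_(V : {ffun B -> 'I_n} | semistandard V) \prod_b box_factor b (V b)
    \is symmetric.
Proof.
apply: adjacent_symmetric => k0 k1 k01.
(* With [j] beyond all columns nothing is prescribed, and [supported] holds vacuously. *)
pose j := (\max_b col b).+1.
have ltj b : (col b < j)%N by rewrite ltnS leq_bigmax.
case: (pickP (fun V : {ffun B -> 'I_n} => semistandard V)) => [V0 _|no_V]; last first.
  by rewrite big_pred0 ?msym0.
have supV0 : supported row col k0 j V0.
  by move=> b cb; have := ltj b; rewrite cb ltnn.
have := msym_swap pos_inj convex W_row W_below k01 supV0.
have E : \sum_(V : {ffun B -> 'I_n} | semistandard V && agrees col j V0 V)
             \prod_(b | (col b < j)%N) box_factor b (V b) =
         \sum_(V : {ffun B -> 'I_n} | semistandard V) \prod_b box_factor b (V b).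
  apply: eq_big => [V|V _]; last exact: eq_bigl.
  rewrite andb_idr // => _; apply/forallP => b.
  by rewrite leqNgt ltj.
by rewrite /= E.
Qed.

(** The two terms of [box_factor]: a bar selects the y variable. *)
Definition entry_factor b (x : 'I_n * bool) : {mpoly R[n]} :=
  if x.2 then (W b x.1)%:MP else 'X_(x.1).

Definition values T : {ffun B -> 'I_n} := [ffun b => (T b).1].

(** Here [k] is a natural number, so that the value [n], which never occurs, may be counted as
    well. *)
Definition unbarred_count T (c k : nat) : nat :=
  #|[pred b | [&& (c <= col b)%N, ~~ (T b).2 & (T b).1 == k :> nat]]|.

Definition unbarred_mnm T c : 'X_{1..n} := [multinom unbarred_count T c k | k < n].

Lemma prod_entry_factor T c : \prod_(b | (c <= col b)%N) entry_factor b (T b) =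
  (\prod_(b | (c <= col b)%N && (T b).2) W b (T b).1) *: 'X_[unbarred_mnm T c].
Proof.
rewrite (bigID (fun b => (T b).2)) /= -mul_mpolyC rmorph_prod; congr (_ * _).
  by apply: eq_bigr => b /andP[_ Tb]; rewrite /entry_factor Tb.
rewrite (eq_bigr (fun b => 'X_[U_((T b).1)%MM])); last first.
  by move=> b /andP[_ /negbTE Tb]; rewrite /entry_factor Tb.
rewrite mprodXE; congr 'X_[_]; apply/mnmP => k.
rewrite mnm_sumE mnmE /unbarred_count -sum1_card [RHS]big_mkcond.
rewrite [LHS]big_mkcond; apply: eq_bigr => b _ /=.
by rewrite inE mnm1E -val_eqE /=; case: (_ <= _)%N; case: (T b).2; case: eqP.
Qed.

(** Encodes the columns at least [c] as a key by which fillings are grouped. *)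
Definition restrict T c : {ffun B -> option ('I_n * bool)} :=
  [ffun b => if (c <= col b)%N then Some (T b) else None].

(** Semistandardness concerns the values only, so bars left of column [j] are free, and summing over
    them in each box gives [box_factor]. *)
Lemma sum_fillings_with (T0 : {ffun B -> 'I_n * bool}) j :
  \sum_(T : {ffun B -> 'I_n * bool} |
        semistandard (values T) && (restrict T j == restrict T0 j))
     \prod_b entry_factor b (T b) =
  \prod_(b | (j <= col b)%N) entry_factor b (T0 b) *
  \sum_(V : {ffun B -> 'I_n} | semistandard V && agrees col j (values T0) V)
     \prod_(b | (col b < j)%N) box_factor b (V b).
Proof.
have agT T : (restrict T j == restrict T0 j) =
    [forall b, (j <= col b)%N ==> (T b == T0 b)].
  apply/eqP/forallP => [e b|h].
    by apply/implyP => le; have /ffunP/(_ b) := e; rewrite !ffunE le => -[->].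
  by apply/ffunP => b; rewrite !ffunE; case: ifP (h b) => //= _ /eqP ->.
rewrite (partition_big values
  (fun V => semistandard V && agrees col j (values T0) V)); last first.
  move=> T /andP[->]; rewrite agT => /forallP h; apply/forallP => b.
  by apply/implyP => le; have := h b; rewrite le !ffunE => /eqP ->.
rewrite big_distrr; apply: eq_bigr => V /andP[ssV /forallP agV] /=.
pose Q b (x : 'I_n * bool) := (x.1 == V b) && ((j <= col b)%N ==> (x == T0 b)).
rewrite (eq_bigl (mem (family Q))); last first.
  move=> T; rewrite agT; apply/idP/familyP => [|QT].
    case/andP => /andP[_ /forallP h] /eqP e b.
    by rewrite unfold_in /Q h -e ffunE eqxx.
  have -> : values T = V.
    by apply/ffunP => b; rewrite ffunE; have := QT b; rewrite unfold_in => /andP[/eqP].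
  rewrite ssV eqxx andbT /=; apply/forallP => b.
  by have := QT b; rewrite unfold_in => /andP[].
rewrite -(bigA_distr_big_dep _ entry_factor).
rewrite (bigID (fun b => (j <= col b)%N)) /=; congr (_ * _).
  apply: eq_bigr => b le; rewrite (big_pred1 (T0 b)) // => x.
  rewrite /Q le /= andb_idl // => /eqP ->.
  by have := agV b; rewrite le ffunE eq_sym.
apply: eq_big => [b|b lt]; first by rewrite ltnNge.
rewrite (reindex_onto (pair (V b)) snd); last first.
  by move=> [v c] /andP[/eqP /= -> _].
rewrite (eq_bigl xpredT) ?big_bool; first by rewrite /entry_factor /box_factor /= addrC.
by move=> c; rewrite /Q /= (negbTE lt) !eqxx.
Qed.

(** The Yamanouchi inequalities at the moment when the columns at least [c] have been read. *)
Definition level T (c : nat) : bool :=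
  [forall k : 'I_n, (unbarred_count T c k.+1 <= unbarred_count T c k)%N].

Let M := (\max_b col b).+1.
Let col_ltM b : (col b < M)%N. Proof. by rewrite ltnS leq_bigmax. Qed.

Definition level_from T (j : nat) : bool :=
  [forall c : 'I_M.+1, (j <= c)%N ==> level T c].

Lemma level_max T : level T M.
Proof.
apply/forallP => k; rewrite /unbarred_count eq_card0 // => b.
by rewrite inE leqNgt col_ltM.
Qed.

Lemma level_all T : [forall c : 'I_M.+1, level T c] -> forall c, level T c.
Proof.
move=> /forallP levT c; have [lt|le] := ltnP c M.+1.
  by have := levT (Ordinal lt).
apply/forallP => k; rewrite /unbarred_count eq_card0 // => b.
by rewrite inE leqNgt (leq_trans (col_ltM b)) // ltnW.
Qed.

Lemma level_from_max T : level_from T M.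
Proof.
apply/forallP => c; apply/implyP => le.
have -> : c = M :> nat by have := ltn_ord c; lia.
exact: level_max.
Qed.

Lemma level_fromS T j : (j < M)%N -> level_from T j = level T j && level_from T j.+1.
Proof.
move=> ltj; have ltj1 : (j < M.+1)%N by lia.
apply/forallP/andP => [h|[lj /forallP h] c].
  split; first by have := h (Ordinal ltj1); rewrite leqnn.
  by apply/forallP => c; apply/implyP => /ltnW le; have := h c; rewrite le.
apply/implyP; rewrite leq_eqVlt => /predU1P[<- //|lt].
by have := h c; rewrite lt.
Qed.

Lemma eq_restrict T T' j : restrict T j = restrict T' j ->
  (forall c k, (j <= c)%N -> unbarred_count T c k = unbarred_count T' c k).
Proof.
move=> e c k le; apply: eq_card => b; rewrite !inE.
case: (leqP c (col b)) => //= le_b; have /ffunP/(_ b) := e.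
by rewrite !ffunE (leq_trans le le_b) => -[->].
Qed.

Lemma level_restrict T T' j : restrict T j = restrict T' j ->
  level T j = level T' j /\ level_from T j.+1 = level_from T' j.+1.
Proof.
move=> e; have lev c : (j <= c)%N -> level T c = level T' c.
  by move=> le; apply: eq_forallb => k; rewrite !(eq_restrict e).
split; first exact: lev.
apply: eq_forallb => c; case: (leqP j.+1 c) => //= lt.
by apply: lev; apply: ltnW.
Qed.

Lemma unbarred_countS T j k : unbarred_count T j k = (unbarred_count T j.+1 k +
  #|[pred b | [&& col b == j, ~~ (T b).2 & (T b).1 == k :> nat]]|)%N.
Proof.
rewrite /unbarred_count -!sum1_card [LHS]big_mkcond /=.
rewrite [X in (X + _)%N]big_mkcond [X in (_ + X)%N]big_mkcond -big_split /=.
apply: eq_bigr => b _.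
by rewrite !inE; case: (~~ _ && _); rewrite ?andbF ?andbT //; case: ltngtP.
Qed.

Lemma column_count_le1 T j k : semistandard (values T) ->
  (#|[pred b | [&& col b == j, ~~ (T b).2 & (T b).1 == k :> nat]]| <= 1)%N.
Proof.
move=> /semistandardP[_ colT]; apply/card_le1_eqP => b b'.
rewrite !inE => /and3P[/eqP cb _ /eqP Tb] /and3P[/eqP cb' _ /eqP Tb'].
apply: pos_inj; last by rewrite cb.
have := colT b b'; have := colT b' b; rewrite cb cb' !ffunE Tb Tb' ltnn.
by move=> /(_ erefl) h1 /(_ erefl) h2; case: (ltngtP (row b) (row b')) => // [/h2|/h1].
Qed.

(* The boxes in columns [>= j] of a filling that first violates the ballot
   condition at column [j] contribute a monomial [m] with [rho + m] fixed by a
   transposition, and the boxes to the left contribute a polynomial with the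
   same symmetry. *)
Lemma sum_first_violation j (T0 : {ffun B -> 'I_n * bool}) : (j < M)%N ->
  semistandard (values T0) -> level_from T0 j.+1 -> ~~ level T0 j ->
  alt ('X_[rho n] * \sum_(T : {ffun B -> 'I_n * bool} |
     semistandard (values T) && (restrict T j == restrict T0 j))
       \prod_b entry_factor b (T b)) = 0.
Proof.
move=> ltj ssT lev /forallPn[k0]; rewrite -ltnNge => viol.
have /forallP/(_ k0) levS : level T0 j.+1.
  by have /forallP/(_ (Ordinal (ltj : (j.+1 < M.+1)%N))) := lev; rewrite /= leqnn.
(* A column adds at most one k+1, so the first violation is by exactly one. *)
have count_eq : unbarred_count T0 j k0.+1 = (unbarred_count T0 j k0).+1.
  move: viol levS; rewrite !(unbarred_countS T0 j).
  by have := column_count_le1 j k0.+1 ssT; lia.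
have : (0 < #|[pred b | [&& col b == j, ~~ (T0 b).2 & (T0 b).1 == k0.+1 :> nat]]|)%N.
  by move: viol levS; rewrite !(unbarred_countS T0 j); lia.
case/card_gt0P => b1; rewrite inE => /and3P[/eqP cb1 _ /eqP Tb1].
have lt_n : (k0.+1 < n)%N by rewrite -Tb1.
pose k1 := Ordinal lt_n; have k01 : k1 = k0.+1 :> nat by [].
have /semistandardP[rowT colT] := ssT.
(* Column [j] contains a k+1, in [b1]; by strictness and convexity, a k in this column is directly
   above it. *)
have supT : supported row col k0 j (values T0).
  move=> b cb; rewrite ffunE => Tb.
  have lt_row : (row b < row b1)%N.
    rewrite ltnNge leq_eqVlt; apply/negP => /predU1P[e|lt].
      by have eb := pos_inj e (etrans cb1 (esym cb)); move: Tb1; rewrite eb Tb; lia.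
    by have := colT b1 b; rewrite cb cb1 !ffunE Tb Tb1 => /(_ erefl lt); lia.
  have rb1 : row b1 = (row b).+1.
    apply/eqP; rewrite eqn_leq lt_row andbT leqNgt; apply/negP => lt.
    have [||d rd cd] := convex (b := b) (b' := b1) (i := (row b).+1) (c := j).
    - by lia.
    - by rewrite cb cb1 leqnn.
    have := colT b d; have := colT d b1; rewrite rd cd cb cb1 !ffunE Tb Tb1.
    by move=> /(_ erefl lt) h1 /(_ erefl (leqnn _)) h2; lia.
  by exists b1 => //; rewrite /partner !ffunE cb cb1 Tb Tb1 rb1 !eqxx.
rewrite sum_fillings_with mulrA.
apply: (@alt_tperm _ _ k0 k1); first by rewrite -val_eqE /=; lia.
rewrite msymM (msym_swap pos_inj convex W_row W_below k01 supT); congr (_ * _).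
rewrite prod_entry_factor -scalerAr -mpolyXD msymZ msymX; congr (_ *: 'X_[_]).
(* The excess of one k+1 makes up for the difference of one between the exponents of rho. *)
apply/mnmP => i; rewrite tpermV !mnmE.
case: tpermP => [->|->|//].
  by rewrite k01 count_eq; lia.
by rewrite k01 count_eq; have := ltn_ord k1; rewrite k01; lia.
Qed.

Let filling_alt T := alt ('X_[rho n] * \prod_b entry_factor b (T b)).

(** The two sides differ by the fillings whose first violation, from the right, is at column [j];
    those with the same columns at least [j] cancel together. *)
Lemma sum_level_step j : (j < M)%N ->
  \sum_(T : {ffun B -> 'I_n * bool} | semistandard (values T) && level_from T j.+1)
     filling_alt T =
  \sum_(T : {ffun B -> 'I_n * bool} | semistandard (values T) && level_from T j)
     filling_alt T.
Proof.
move=> ltj; rewrite (bigID (fun T => level T j)) /= [X in _ + X](_ : _ = 0).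
  by rewrite addr0; apply: eq_bigl => T; rewrite (level_fromS T ltj) andbCA andbC.
rewrite (partition_big (restrict^~ j) xpredT) //=; apply: big1 => K _.
case: (pickP (fun T => (semistandard (values T) && level_from T j.+1) &&
  ~~ level T j && (restrict T j == K))) => [T0|no_T]; last by rewrite big_pred0.
case/andP => /andP[/andP[ssT0 lev] nlev] /eqP <-{K}.
rewrite (eq_bigl (fun T => semistandard (values T) && (restrict T j == restrict T0 j))).
  by rewrite /filling_alt -alt_sum -mulr_sumr sum_first_violation.
move=> T; rewrite -2!andbA; congr (_ && _); case: (eqVneq _ (restrict T0 j)) => [e|_].
  by have [-> ->] := level_restrict e; rewrite lev nlev.
by rewrite !andbF.
Qed.

(** The symmetric factor moves inside [alt], is expanded into barred fillings, and the violating
    ones are discarded column by column. *)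
Theorem alt_sum_fillings :
  alt 'X_[rho n] *
    \sum_(V : {ffun B -> 'I_n} | semistandard V) \prod_b box_factor b (V b) =
  \sum_(T : {ffun B -> 'I_n * bool} |
        semistandard (values T) && [forall c : 'I_M.+1, level T c])
    (\prod_(b | (T b).2) W b (T b).1) *: alt 'X_[rho n + unbarred_mnm T 0].
Proof.
rewrite -altM_sym ?symmetric_sum_fillings //.
transitivity (\sum_(T : {ffun B -> 'I_n * bool} |
    semistandard (values T) && level_from T 0) filling_alt T); last first.
  apply: eq_bigr => T _; rewrite /filling_alt.
  rewrite (eq_bigl (fun b => 0 <= col b)%N) // prod_entry_factor.
  by rewrite -scalerAr -mpolyXD altZ.
have -> : \sum_(T : {ffun B -> 'I_n * bool} |
    semistandard (values T) && level_from T 0) filling_alt T =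
  \sum_(T : {ffun B -> 'I_n * bool} | semistandard (values T)) filling_alt T.
  suff E j : (j <= M)%N -> \sum_(T : {ffun B -> 'I_n * bool} |
      semistandard (values T) && level_from T (M - j)) filling_alt T =
    \sum_(T : {ffun B -> 'I_n * bool} | semistandard (values T)) filling_alt T.
    by have := E M (leqnn M); rewrite subnn.
  elim: j => [_|j IHj ltj].
    by apply: eq_bigl => T; rewrite subn0 level_from_max andbT.
  have eM : (M - j = (M - j.+1).+1)%N by lia.
  by rewrite -IHj ?(ltnW ltj) // eM sum_level_step //; lia.
case: (pickP (fun V : {ffun B -> 'I_n} => semistandard V)) => [V0 ssV0|no_V]; last first.
  by rewrite big_pred0 // mulr0 alt0 big_pred0 // => T; apply: no_V.
(* No column reaches [M], so [T0] prescribes nothing and [sum_fillings_with] is the full expansion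
   over bars. *)
pose T0 : {ffun B -> 'I_n * bool} := [ffun b => (V0 b, false)].
have := sum_fillings_with T0 M.
have none b : (M <= col b)%N = false by rewrite leqNgt col_ltM.
rewrite big_pred0 // mul1r => E; rewrite /filling_alt -alt_sum -mulr_sumr.
congr (alt (_ * _)); symmetry.
transitivity (\sum_(V : {ffun B -> 'I_n} | semistandard V && agrees col M (values T0) V)
     \prod_(b | (col b < M)%N) box_factor b (V b)).
  rewrite -E; apply: eq_bigl => T; rewrite andb_idr // => _.
  by apply/eqP/ffunP => b; rewrite !ffunE none.
apply: eq_big => [V|V _]; last by apply: eq_bigl => b; rewrite col_ltM.
rewrite andb_idr // => _; apply/forallP => b.
by rewrite none.
Qed.

End Cancellation.

(** * Straight shapes *)

(** Distributivity with index types depending on the factor; it glues tableaux of the single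
    diagrams into one filling of the skew diagram. *)
Lemma prod_sum_sigma (R : comNzRingType) (I : finType) (J : I -> finType)
    (K : finType) (P : forall i, pred {ffun J i -> K}) (F : forall i, J i -> K -> R) :
  \prod_i \sum_(f : {ffun J i -> K} | P i f) \prod_j F i j (f j) =
  \sum_(g : {ffun {i : I & J i} -> K} |
        [forall i, P i [ffun j => g (Tagged J j)]])
     \prod_s F (tag s) (tagged s) (g s).
Proof.
pose T_ (i : I) : finType := {ffun J i -> K}.
(* Extension by zero removes the condition [P i], so that the choices are all dependent
   functions. *)
pose G i : {ffun T_ i -> R} := [ffun f => if P i f then \prod_j F i j (f j) else 0].
transitivity (\prod_i \sum_(f : T_ i) G i f).
  by apply: eq_bigr => i _; rewrite big_mkcond; apply: eq_bigr => f _; rewrite ffunE.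
under eq_bigr => i _ do rewrite (big_tag (fun i (f : T_ i) => G i f)).
rewrite bigA_distr_big_dep -big_fprod /=.
pose h (g : {ffun {i : I & J i} -> K}) : fprod T_ :=
  [fprod i : I => [ffun j : J i => g (Tagged J j)] : T_ i].
pose h' (t : fprod T_) : {ffun {i : I & J i} -> K} :=
  [ffun s => (t (tag s) : {ffun J (tag s) -> K}) (tagged s)].
have h_bij : bijective h.
  exists h' => [g|t]; first by apply/ffunP => -[i j]; rewrite ffunE fprodE ffunE.
  by apply/fprodP => i; rewrite fprodE; apply/ffunP => j; rewrite !ffunE.
rewrite (reindex h) /=; last exact: onW_bij.
rewrite [RHS]big_mkcond; apply: eq_bigr => g _.
case: ifPn => [/forallP Pg|/forallPn[i nPg]]; last first.
  by rewrite (bigD1 i) //= ffunE fprodE (negbTE nPg) mul0r.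
under eq_bigr => i _ do rewrite ffunE fprodE Pg.
rewrite (sig_big_dep _ (fun i => xpredT) (fun i j => F i j _)) /=.
by apply: eq_bigr => -[i j] _ /=; rewrite ffunE.
Qed.

Section Box.
Variables (n : nat) (mu : npartition n).

Lemma npartition_geq (i j : 'I_n) : (i <= j)%N -> (tnth mu j <= tnth mu i)%N.
Proof.
move=> ij; rewrite !(tnth_nth 0%N).
have geq_tr : transitive geq by move=> a b c h1 h2; apply: leq_trans h2 h1.
apply: (sorted_leq_nth geq_tr _ 0%N (parts_sorted mu)) => //=;
  by [exact: leqnn | rewrite inE size_tuple].
Qed.

Lemma box_inj (b b' : box mu) :
  box_row b = box_row b' -> box_col b = box_col b' -> b = b'.
Proof.
case: b b' => i c [i' c']; rewrite /box_row /box_col /= => /val_inj e.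
by case: _ / e c' => c' /val_inj ->.
Qed.

Lemma box_exists (b : box mu) (i c : nat) : (i <= box_row b)%N ->
  (c <= box_col b)%N -> exists2 d : box mu, box_row d = i & box_col d = c.
Proof.
case: b => i' c' /=; rewrite /box_row /box_col /= => le_i le_c.
have lt_i : (i < n)%N := leq_ltn_trans le_i (ltn_ord i').
have lt_c : (c < tnth mu (Ordinal lt_i))%N.
  apply: leq_ltn_trans le_c _; apply: leq_trans (ltn_ord c') _.
  exact: npartition_geq.
by exists (Tagged (fun i : 'I_n => 'I_(tnth mu i)) (Ordinal lt_c)).
Qed.

Lemma box_convex (b b' : box mu) (i c : nat) :
  (box_row b <= i <= box_row b')%N -> (box_col b <= c <= box_col b')%N ->
  exists2 d : box mu, box_row d = i & box_col d = c.
Proof. by move=> /andP[_ le_i] /andP[_ le_c]; apply: box_exists le_i le_c. Qed.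

Lemma semistandard_row_le (V : box mu -> 'I_n) (b : box mu) :
  semistandard (@box_row n mu) (@box_col n mu) V -> (box_row b <= V b)%N.
Proof.
move=> /semistandardP[_ colV]; move: {2}(box_row b) (erefl (box_row b)) => i.
elim: i b => [|i IHi] b rb; first by rewrite rb.
have [||d rd cd] := @box_exists b i (box_col b); rewrite ?rb //.
by have := colV d b cd; rewrite rd rb ltnSn => /(_ isT); have := IHi d rd; lia.
Qed.

Definition part_mnm : 'X_{1..n} := [multinom tnth mu i | i < n].

Lemma part_mnm_dec : strictly_decreasing (rho n + part_mnm)%MM.
Proof.
by apply: rho_add_dec => i j ij; rewrite !mnmE npartition_geq.
Qed.

(** The highest weight tableau: row i holds only i. *)
Definition row_filling : {ffun box mu -> 'I_n * bool} :=
  [ffun b => (tag b, false)].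

Lemma sum_ord_ge m c : (\sum_(i < m | c <= i) 1 = m - c)%N.
Proof.
elim: m => [|m IHm]; first by rewrite big_ord0.
by rewrite big_mkcond big_ord_recr -big_mkcond /= IHm; case: ifP; lia.
Qed.

Lemma unbarred_count_row_filling c (k : 'I_n) :
  unbarred_count (@box_col n mu) row_filling c k = (tnth mu k - c)%N.
Proof.
rewrite /unbarred_count -sum1_card.
rewrite (eq_bigl (fun b : box mu => (tag b == k) && (c <= tagged b)%N)); last first.
  by move=> b; rewrite inE ffunE /= andbC.
rewrite -(sig_big_dep (pred1 k) (fun (i : 'I_n) (j : 'I_(tnth mu i)) => c <= j)%N
  (fun _ _ => 1%N)) /=.
by rewrite big_pred1_eq sum_ord_ge.
Qed.

Lemma row_filling_semistandard :
  semistandard (@box_row n mu) (@box_col n mu) (values row_filling).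
Proof.
by apply/semistandardP; split=> b b'; rewrite !ffunE /box_row => // ->.
Qed.

Lemma row_filling_level c : level (@box_col n mu) row_filling c.
Proof.
apply/forallP => k; rewrite unbarred_count_row_filling.
have [lt|ge] := ltnP k.+1 n.
  rewrite (unbarred_count_row_filling c (Ordinal lt)) leq_sub2r //.
  exact: npartition_geq.
rewrite /unbarred_count eq_card0 // => b; rewrite inE.
apply/negbTE/negP => /and3P[_ _ /eqP e].
by have := ltn_ord (row_filling b).1; rewrite e; lia.
Qed.

(** Among the boxes with entry above their row index, take the topmost one [b] in the rightmost
    column having any. The level condition at its column needs an entry one smaller in this column
    or further right. Further right, rows end above [b] and entries are too small; in the same
    column, such an entry would be bad and higher. *)
Lemma row_filling_unique (T : {ffun box mu -> 'I_n * bool}) :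
  semistandard (@box_row n mu) (@box_col n mu) (values T) ->
  (forall c, level (@box_col n mu) T c) -> (forall b, (T b).2 = false) ->
  T = row_filling.
Proof.
move=> ssT lev nobar; have /semistandardP[rowT colT] := ssT.
pose bad b := (box_row b < (T b).1)%N.
have ge_row b : (box_row b <= (T b).1)%N.
  by have := semistandard_row_le b ssT; rewrite ffunE.
suff no_bad b0 : ~~ bad b0.
  apply/ffunP => b; rewrite ffunE -(nobar b) [LHS]surjective_pairing; congr (_, _).
  by apply/val_inj/eqP; rewrite eqn_leq /= (ge_row b) leqNgt no_bad.
apply/negP => bad_b0.
case: (@arg_maxnP _ b0 bad (@box_col n mu) bad_b0) => b1 bad1 max1.
pose bad' b := bad b && (box_col b == box_col b1).
have bad'1 : bad' b1 by rewrite /bad' bad1 eqxx.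
case: (@arg_minnP _ b1 bad' (@box_row n mu) bad'1) => b /andP[bad_b /eqP cb] min_b.
have right_short (d : box mu) : (box_col b < box_col d)%N -> (box_row d < box_row b)%N.
  move=> lt; rewrite ltnNge; apply/negP => le.
  have [e re ce] := box_exists le lt.
  have nbad : ~~ bad e by apply/negP => /max1; rewrite /= ce cb ltnn.
  have := rowT b e; rewrite re ce !ffunE => /(_ erefl (leqnSn _)).
  by move: bad_b nbad; rewrite /bad re; lia.
have lt_n : ((T b).1.-1 < n)%N by have := ltn_ord (T b).1; lia.
have ltT : (0 < (T b).1)%N by apply: leq_ltn_trans bad_b.
have /forallP/(_ (Ordinal lt_n)) := lev (box_col b).
rewrite /= prednK // leqNgt => /negP; apply.
rewrite {1}/unbarred_count eq_card0 => [|e].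
  by apply/card_gt0P; exists b; rewrite inE leqnn nobar eqxx.
rewrite inE; apply/negbTE/negP => /and3P[le_e _ /eqP Te].
have e_ge := ge_row e.
have ce : box_col e = box_col b.
  apply/eqP; rewrite eqn_leq le_e andbT leqNgt; apply/negP => lt.
  have nbad : ~~ bad e by apply/negP => /max1; rewrite /= -cb leqNgt lt.
  move: nbad; rewrite /bad Te -leqNgt => /leq_ltn_trans /(_ (right_short e lt)).
  by rewrite prednK // leqNgt => /negP; apply.
have lt_row : (box_row e < box_row b)%N.
  rewrite ltnNge leq_eqVlt; apply/negP => /predU1P[e_eq|lt].
    have eb := box_inj e_eq (esym ce); by have := ltT; rewrite -ltn_predL -Te -eb ltnn.
  by have := colT b e (esym ce) lt; rewrite !ffunE Te ltnNge leq_pred.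
have := min_b e; rewrite /bad' ce cb eqxx andbT /bad Te.
have -> : (box_row e < (T b).1.-1)%N.
  by rewrite -ltnS prednK // (leq_ltn_trans lt_row).
by move=> /(_ isT); rewrite leqNgt lt_row.
Qed.

(** With zero weights barred fillings vanish, and [row_filling] is the only one left. *)
Lemma alt_schur (R : comNzRingType) :
  alt 'X_[rho n] * schur R mu = alt 'X_[rho n + part_mnm].
Proof.
have -> : schur R mu =
    \sum_(V : {ffun box mu -> 'I_n} | semistandard (@box_row n mu) (@box_col n mu) V)
      \prod_b box_factor (fun _ _ => 0) b (V b).
  apply: eq_big => [V|V _]; first by rewrite inE.
  by apply: eq_bigr => b _; rewrite /box_factor mpolyC0 addr0.
rewrite (@alt_sum_fillings _ _ _ _ _ box_inj box_convex _ (fun _ _ => 0)) //.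
rewrite (bigD1 row_filling) /=; last first.
  by rewrite row_filling_semistandard; apply/forallP => c; apply: row_filling_level.
rewrite big_pred0 => [|b]; last by rewrite ffunE.
rewrite scale1r [X in _ + X]big1 ?addr0 => [|T /andP[/andP[ssT levT] neqT]].
  congr (alt 'X_[_ + _]); apply/mnmP => k.
  by rewrite !mnmE unbarred_count_row_filling subn0.
case: (pickP (fun b => (T b).2)) => [b Tb|nobar].
  by rewrite (bigD1 b) //= mul0r scale0r.
by case/eqP: neqT; apply: (row_filling_unique ssT (level_all levT)).
Qed.
End Box.

(** * Skew diagrams of the product *)

Section SkewBox.
Variables (n r : nat) (lam : 'I_r -> npartition n).
Implicit Types (b d : skew_box lam).

Lemma box_row_lt_count (mu : npartition n) (b : box mu) :
  (box_row b < count (fun k => 0 < k)%N mu)%N.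
Proof.
have size_ge : (box_row b < size mu)%N by rewrite size_tuple /box_row ltn_ord.
rewrite -(cat_take_drop (box_row b).+1 mu) count_cat.
have -> : count (fun k => 0 < k)%N (take (box_row b).+1 mu) = (box_row b).+1.
  rewrite -{2}(size_takel size_ge); apply/eqP; rewrite -all_count.
  apply/(all_nthP 0%N) => i; rewrite size_takel // ltnS => le_i.
  rewrite nth_take ?ltnS //.
  have lt_n : (i < n)%N by apply: leq_ltn_trans le_i (ltn_ord (tag b)).
  rewrite -(tnth_nth 0%N mu (Ordinal lt_n)).
  by rewrite (leq_trans _ (@npartition_geq _ mu (Ordinal lt_n) (tag b) le_i)) //
    (leq_ltn_trans _ (ltn_ord (tagged b))).
by rewrite leq_addr.
Qed.

Lemma box_col_lt_head (mu : npartition n) (b : box mu) :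
  (box_col b < head 0%N mu)%N.
Proof.
have n_gt0 : (0 < n)%N by apply: leq_ltn_trans (ltn_ord (tag b)).
rewrite -nth0 -(tnth_nth 0%N mu (Ordinal n_gt0)).
by apply: leq_trans (ltn_ord (tagged b)) _; apply: npartition_geq.
Qed.

Lemma skew_row_lt b b' : (tag b < tag b')%N -> (skew_row b < skew_row b')%N.
Proof.
move=> lt; rewrite /skew_row.
rewrite [X in (_ < X + _)%N](bigD1 (tag b)) //=.
have lt_c := box_row_lt_count (tagged b).
suff le : (\sum_(q < r | (q < tag b)%N) count (fun k => 0 < k)%N (lam q) <=
  \sum_(q < r | (q < tag b')%N && (q != tag b)) count (fun k => 0 < k)%N (lam q))%N.
  by rewrite [X in (X < _)%N]addnC (leq_trans (leq_add lt_c le)) ?leq_addr.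
rewrite [leqLHS]big_mkcond [leqRHS]big_mkcond; apply: leq_sum => q _.
by case: ifP => // lt_q; rewrite ifT // (ltn_trans lt_q lt) -val_eqE neq_ltn lt_q.
Qed.

Lemma skew_col_lt b b' : (tag b < tag b')%N -> (skew_col b' < skew_col b)%N.
Proof.
move=> lt; rewrite /skew_col.
rewrite [X in (_ < X + _)%N](bigD1 (tag b')) //=.
have lt_c := box_col_lt_head (tagged b').
suff le : (\sum_(q < r | (tag b' < q)%N) head 0%N (lam q) <=
  \sum_(q < r | (tag b < q)%N && (q != tag b')) head 0%N (lam q))%N.
  by rewrite [X in (X < _)%N]addnC (leq_trans (leq_add lt_c le)) ?leq_addr.
rewrite [leqLHS]big_mkcond [leqRHS]big_mkcond; apply: leq_sum => q _.
by case: ifP => // lt_q; rewrite ifT // (ltn_trans lt lt_q) -val_eqE neq_ltn lt_q orbT.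
Qed.

(** Later diagrams lie strictly lower and strictly further left, so no box is weakly south-east of a
    box of another diagram. *)
Lemma skew_tag_eq b b' : (skew_row b <= skew_row b')%N ->
  (skew_col b <= skew_col b')%N -> tag b = tag b'.
Proof.
move=> le_row le_col; apply/val_inj; case: (ltngtP (tag b) (tag b')) => //.
  by move/skew_col_lt; rewrite ltnNge le_col.
by move/skew_row_lt; rewrite ltnNge le_row.
Qed.

Lemma skew_row_tag b b' : skew_row b = skew_row b' -> tag b = tag b'.
Proof.
move=> e; apply/val_inj; case: (ltngtP (tag b) (tag b')) => // /skew_row_lt;
  by rewrite e ltnn.
Qed.

Lemma skew_col_tag b b' : skew_col b = skew_col b' -> tag b = tag b'.
Proof.
move=> e; apply/val_inj; case: (ltngtP (tag b) (tag b')) => // /skew_col_lt;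
  by rewrite e ltnn.
Qed.

Lemma skew_inj b b' :
  skew_row b = skew_row b' -> skew_col b = skew_col b' -> b = b'.
Proof.
move=> er ec; have et := skew_row_tag er; case: b b' et er ec => p x [q x'] /= et.
case: _ / et x' => x'; rewrite /skew_row /skew_col /= => /addnI er /addnI ec.
by congr Tagged; apply: box_inj.
Qed.

Lemma skew_convex b b' (i c : nat) :
  (skew_row b <= i <= skew_row b')%N -> (skew_col b <= c <= skew_col b')%N ->
  exists2 d : skew_box lam, skew_row d = i & skew_col d = c.
Proof.
move=> /andP[i1 i2] /andP[c1 c2].
have et := skew_tag_eq (leq_trans i1 i2) (leq_trans c1 c2).
case: b b' et i1 i2 c1 c2 => p x [q x'] /= et.
case: _ / et x' => x'; rewrite /skew_row /skew_col /=.
set offr := (\sum_(_ < _ | _) _)%N; set offc := (\sum_(_ < _ | _) _)%N.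
move=> i1 i2 c1 c2.
have [||d rd cd] := @box_exists _ _ x' (i - offr)%N (c - offc)%N; try lia.
exists (Tagged (fun p => box (lam p)) d); rewrite /skew_row /skew_col /= ?rd ?cd.
  by rewrite -/offr subnKC // (leq_trans (leq_addr _ _) i1).
by rewrite -/offc subnKC // (leq_trans (leq_addr _ _) c1).
Qed.

Definition bar_factor b (v : nat) : Zy r :=
  yvar (tag b) (v + box_col (tagged b) - box_row (tagged b))%N.

(* [bar_factor b v] read off the row of [b] and [v + skew_col b] only: the entry
   [v + 1] in a box has the same variable as the entry [v] in the next box. *)
Definition bar_diagonal (i m : nat) : Zy r :=
  if [pick b : skew_box lam | skew_row b == i] is Some b then
    yvar (tag b) (m - \sum_(q < r | (tag b < q)%N) head 0%N (lam q) -
                  box_row (tagged b))%N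
  else 0.

Lemma bar_factor_row b v : bar_factor b v = bar_diagonal (skew_row b) (v + skew_col b).
Proof.
rewrite /bar_diagonal; case: pickP => [d /eqP e|/(_ b)]; last by rewrite eqxx.
have et := skew_row_tag e; rewrite /bar_factor /skew_col.
case: d b et e => p x [q x'] /= et; case: _ / et x' => x'.
rewrite /skew_row /= => /addnI ->; congr yvar; lia.
Qed.

Lemma bar_factor_below b b' v : skew_col b' = skew_col b ->
  skew_row b' = (skew_row b).+1 -> bar_factor b' v.+1 = bar_factor b v.
Proof.
move=> ec er; have et := skew_col_tag ec; rewrite /bar_factor.
case: b' b et ec er => p x [q x'] /= et; case: _ / et x' => x'.
rewrite /skew_row /skew_col /= -addnS => /addnI -> /addnI ->; congr yvar; lia.
Qed.

Local Notation row := (@skew_row n r lam).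
Local Notation col := (@skew_col n r lam).

(** Distinct diagrams share neither rows nor columns, so the conditions decouple. *)
Lemma skew_semistandard (V : {ffun skew_box lam -> 'I_n}) :
  semistandard row col V =
  [forall p, [ffun x : box (lam p) => V (Tagged (fun p => box (lam p)) x)]
               \in ssyt (lam p)].
Proof.
apply/semistandardP/forallP => [[rowV colV] p|ssV].
  rewrite inE; apply/forallP => x; apply/forallP => x'; rewrite !ffunE.
  apply/andP; split; apply/implyP => /andP[/eqP e le].
    by apply: rowV; rewrite /skew_row /skew_col /= ?e ?leq_add2l.
  by apply: colV; rewrite /skew_row /skew_col /= ?e ?ltn_add2l.
have ssp p (x x' : box (lam p)) :=
  elimT forallP (elimT forallP (etrans (esym (in_set _ _)) (ssV p)) x) x'.
split=> b b' e le.
  have et := skew_row_tag e; case: b b' et e le => p x [q x'] /= et.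
  case: _ / et x' => x'; rewrite /skew_row /skew_col /= leq_add2l => /addnI e le.
  by have := ssp p x x'; rewrite e eqxx le !ffunE /= => /andP[].
have et := skew_col_tag e; case: b b' et e le => p x [q x'] /= et.
case: _ / et x' => x'; rewrite /skew_row /skew_col /= ltn_add2l => /addnI e le.
by have := ssp p x x'; rewrite e eqxx le !ffunE /= => /andP[].
Qed.

Lemma prod_factorial_schur :
  \prod_(p < r) factorial_schur (lam p) (yvar p) =
  \sum_(V : {ffun skew_box lam -> 'I_n} | semistandard row col V)
    \prod_b box_factor bar_factor b (V b).
Proof.
rewrite (prod_sum_sigma (fun p T => T \in ssyt (lam p))
  (fun p (x : box (lam p)) v =>
     'X_v + (yvar p (v + box_col x - box_row x)%N)%:MP)).
by apply: eq_big => // V; rewrite skew_semistandard.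
Qed.

Lemma barred_semistandard (T : filling lam) :
  barred_skew_tableau T = semistandard row col (values T).
Proof.
by apply: eq_forallb => b; apply: eq_forallb => b'; rewrite !ffunE.
Qed.

Lemma unbarred_contentE (T : filling lam) :
  [multinom tnth (unbarred_content T) k | k < n] = unbarred_mnm col T 0.
Proof.
apply/mnmP => k; rewrite !mnmE tnth_mktuple cardsE.
by apply: eq_card => b; rewrite !inE.
Qed.

Lemma column_order_total : total (@column_order n r lam).
Proof. by move=> b b'; rewrite /column_order; lia. Qed.

Lemma column_order_trans : transitive (@column_order n r lam).
Proof. by move=> d b b'; rewrite /column_order; lia. Qed.

(** Columns at least [c] form an initial segment of the word. Conversely, only the leftmost column
    with a [j] in a given initial segment has to be tested, since inside a column [i] is read before
    [j = i.+1]. *)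
Lemma yamanouchi_level (T : filling lam) : semistandard row col (values T) ->
  (yamanouchi (unbarred_column_word T) <-> (forall c, level col T c)).
Proof.
move=> /semistandardP[_ colT].
set s := sort (@column_order n r lam) (enum (skew_box lam)).
have s_sorted : sorted (@column_order n r lam) s := sort_sorted column_order_total _.
have mem_s b : b \in s by rewrite mem_sort mem_enum.
have uniq_s : uniq s by rewrite sort_uniq enum_uniq.
set u := [seq b <- s | ~~ (T b).2].
have word_eq : unbarred_column_word T = [seq (T b).1 | b <- u] by [].
have u_sorted : sorted (@column_order n r lam) u.
  exact: sorted_filter column_order_trans _ _ s_sorted.
have mem_u b : (b \in u) = ~~ (T b).2 by rewrite mem_filter mem_s andbT.
have uniq_u : uniq u by rewrite filter_uniq.
have order_refl : reflexive (@column_order n r lam).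
  by move=> b; rewrite /column_order eqxx leqnn orbT.
have before (b d : skew_box lam) m : d \in take m u -> b \in u ->
    ~~ column_order d b -> b \in take m u.
  move=> d_take b_u nle; have d_u := mem_take d_take.
  rewrite in_take //; rewrite in_take // in d_take; apply: ltn_trans d_take.
  rewrite ltnNge; apply: contra nle.
  exact: (sorted_leq_index column_order_trans order_refl u_sorted _ _ d_u b_u).
have countE m (k : 'I_n) : count_mem k (take m (unbarred_column_word T)) =
    #|[pred b | (b \in take m u) && ((T b).1 == k)]|.
  rewrite word_eq -map_take count_map -size_filter.
  rewrite -(card_uniqP (filter_uniq _ (take_uniq _ uniq_u))).
  by apply: eq_card => b; rewrite mem_filter andbC.
split=> [yam c|lev].
  apply/forallP => k; have [lt_n|ge_n] := ltnP k.+1 n; last first.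
    rewrite /unbarred_count eq_card0 // => b; rewrite inE.
    apply/negbTE/negP => /and3P[_ _ /eqP e].
    by have := ltn_ord (T b).1; rewrite e ltnNge ge_n.
  (* The length of the initial segment read before a column less than [c] is entered. *)
  pose m := find (fun b => (col b < c)%N) u.
  have take_m b : (b \in take m u) = ~~ (T b).2 && (c <= col b)%N.
    rewrite -mem_u; apply/idP/andP => [b_take|[b_u le]].
      have b_u := mem_take b_take; split=> //; rewrite leqNgt.
      rewrite in_take // in b_take; have := before_find b b_take.
      by rewrite nth_index // => ->.
    rewrite in_take // ltnNge; apply/negP => ge_m.
    have m_lt : (m < size u)%N by apply: leq_ltn_trans ge_m _; rewrite index_mem.
    have := nth_find b (etrans (has_find _ _) m_lt); rewrite -/m => lt_c.
    have := sorted_leq_nth column_order_trans order_refl b u_sorted.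
    move=> /(_ m (index b u)); rewrite !inE m_lt index_mem b_u => /(_ isT isT ge_m).
    by rewrite nth_index // /column_order; lia.
  have m_le : (m < (size (unbarred_column_word T)).+1)%N.
    by rewrite ltnS word_eq size_map find_size.
  have /forallP/(_ (Ordinal m_le))/forallP/(_ k)/forallP/(_ (Ordinal lt_n)) := yam.
  rewrite /= eqxx !countE /=.
  have eq_count (i : 'I_n) : #|[pred b | (b \in take m u) && ((T b).1 == i)]| =
      unbarred_count col T c i.
    by apply: eq_card => b; rewrite !inE take_m -val_eqE /= andbAC andbC andbA.
  by rewrite !eq_count.
apply/forallP => m; apply/forallP => i; apply/forallP => j; apply/implyP => /eqP ji.
rewrite !countE.
case: (pickP [pred b | (b \in take m u) && ((T b).1 == j)]) => [b0 P0|no_b]; last first.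
  by rewrite eq_card0.
case: (@arg_minnP _ b0 [pred b | (b \in take m u) && ((T b).1 == j)]
  (@skew_col n r lam) P0).
(* All counted [j] lie in columns at least [col b], and every unbarred [i] there is read before
   [b]. *)
move=> b /andP[b_take /eqP Tb] min_b.
have /forallP/(_ i) := lev (col b); rewrite -ji => lev_b.
apply: leq_trans (leq_trans lev_b _).
  apply: subset_leq_card; apply/subsetP => d /[dup] Pd.
  rewrite inE => /andP[d_take /eqP Td].
  by rewrite inE (min_b d Pd) -mem_u (mem_take d_take) Td eqxx.
apply: subset_leq_card; apply/subsetP => d; rewrite !inE => /and3P[le_d nbar Td].
rewrite -val_eqE Td andbT; apply: (before _ b) => //; first by rewrite mem_u.
rewrite /column_order negb_or -leqNgt le_d /= negb_and -ltnNge.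
case: eqP => //= ec; rewrite ltnNge leq_eqVlt; apply/negP => /predU1P[er|lt].
  by have e := skew_inj er ec; move: Td; rewrite -e Tb ji; lia.
by have := colT b d ec lt; rewrite !ffunE Tb ji (eqP Td); lia.
Qed.

End SkewBox.

(** * Expansion in Schur polynomials *)

Section Expansion.
Variables (n r : nat) (lam : 'I_r -> npartition n).
Implicit Types (mu : npartition n) (T : filling lam).

Local Notation f := (\prod_(p < r) factorial_schur (lam p) (yvar p)).
Local Notation lr_filling T :=
  (barred_skew_tableau T && yamanouchi (unbarred_column_word T)).

Lemma part_mnm_inj : injective (@part_mnm n).
Proof.
move=> mu nu /mnmP e; apply/val_inj/eq_from_tnth => i.
by have := e i; rewrite !mnmE.
Qed.

Lemma LRE mu T : (T \in LR lam mu) =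
  lr_filling T && (unbarred_mnm (@skew_col n r lam) T 0 == part_mnm mu).
Proof.
rewrite inE andbA andbAC -unbarred_contentE; congr (_ && _).
apply/eqP/eqP => [e|/mnmP e]; first by apply/mnmP => k; rewrite !mnmE e.
by apply/eq_from_tnth => k; have := e k; rewrite !mnmE.
Qed.

Lemma alt_prod_factorial_schur : alt 'X_[rho n] * f =
  \sum_(T | lr_filling T)
    bar_weight T *: alt 'X_[rho n + unbarred_mnm (@skew_col n r lam) T 0].
Proof.
rewrite prod_factorial_schur.
rewrite (@alt_sum_fillings _ _ _ _ _ (@skew_inj n r lam) (@skew_convex n r lam)
  _ _ (@bar_factor_row n r lam) (@bar_factor_below n r lam)).
apply: eq_bigl => T; rewrite barred_semistandard; apply: andb_id2l => ssT.
have [yamP Pyam] := yamanouchi_level ssT.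
apply/idP/idP => [/level_all/Pyam //|/yamP lev].
by apply/forallP => c; apply: lev.
Qed.

(** At column 0 the level condition covers the whole word and says that the content decreases
    weakly. *)
Lemma lr_filling_content T : lr_filling T ->
  exists mu, unbarred_mnm (@skew_col n r lam) T 0 = part_mnm mu.
Proof.
rewrite barred_semistandard => /andP[ssT]; have [yamP _] := yamanouchi_level ssT.
move=> /yamP/(_ 0%N)/forallP lev.
have sortedT : sorted geq (unbarred_content T).
  apply/(sortedP 0%N) => i; rewrite size_tuple => lt.
  have lt' := ltnW lt; have := lev (Ordinal lt').
  have /mnmP e := unbarred_contentE T.
  have := e (Ordinal lt); have := e (Ordinal lt').
  by rewrite !mnmE !(tnth_nth 0%N) /= => -> ->.
exists (Partition sortedT); rewrite -unbarred_contentE.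
by apply/mnmP => k; rewrite !mnmE.
Qed.

Lemma LR_coef mu : (alt 'X_[rho n] * f)@_(rho n + part_mnm mu) =
  \sum_(T in LR lam mu) bar_weight T.
Proof.
rewrite alt_prod_factorial_schur raddf_sum (eq_bigl _ _ (LRE mu)).
rewrite [RHS]big_mkcondr; apply: eq_bigr => T lrT /=.
have [nu e] := lr_filling_content lrT.
rewrite mcoeffZ e mcoeff_alt_dec; [|exact: part_mnm_dec ..].
by rewrite eqm_add2l; case: eqP; rewrite ?mulr1 ?mulr0.
Qed.

Lemma alt_schur_sum (s : seq (npartition n)) (c : npartition n -> Zy r) :
  alt 'X_[rho n] * (\sum_(mu <- s) c mu *: schur (Zy r) mu) =
  \sum_(mu <- s) c mu *: alt 'X_[rho n + part_mnm mu].
Proof.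
by rewrite mulr_sumr; apply: eq_bigr => mu _; rewrite -scalerAr alt_schur.
Qed.

(** After multiplication by a_rho the Schur polynomials become alternants, of which only that of
    [mu] has the exponent [rho n + part_mnm mu]. The coefficients are therefore determined by
    [g]. *)
Lemma schur_expansion_coef (g : {mpoly (Zy r)[n]})
    (c : {fsfun npartition n -> Zy r with 0}) (mu : npartition n) :
  schur_expansion g c -> c mu = (alt 'X_[rho n] * g)@_(rho n + part_mnm mu).
Proof.
move=> ->; rewrite alt_schur_sum raddf_sum /=.
rewrite (eq_bigr (fun nu => if nu == mu then c nu else 0)); last first.
  move=> nu _; rewrite mcoeffZ mcoeff_alt_dec; [|exact: part_mnm_dec ..].
  rewrite eqm_add2l (inj_eq part_mnm_inj).
  by case: eqP; rewrite ?mulr1 ?mulr0.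
rewrite -big_mkcond -big_filter.
have [mu_in|mu_out] := boolP (mu \in finsupp c).
  by rewrite filter_pred1_uniq ?fset_uniq // big_seq1.
rewrite fsfun_dflt //; rewrite big_filter big_seq_cond big_pred0 // => nu.
by case: eqP => [->|]; rewrite ?andbF // (negbTE mu_out).
Qed.

Lemma LR_schur_expansion : exists c : {fsfun npartition n -> Zy r with 0},
  schur_expansion f c.
Proof.
have lreg_rho : GRing.lreg (alt 'X_[rho n] : {mpoly (Zy r)[n]}).
  apply: lreg_alt; have := @rho_add_dec n 0%MM; rewrite addm0; apply.
  by move=> i j _; rewrite !mnm0E.
(* The content of an arbitrary filling need not be a partition, hence the option. *)
pose content T : option (npartition n) := insub (unbarred_content T).
pose S := [fset mu in pmap content (enum (filling lam))]%fset.
pose c : {fsfun npartition n -> Zy r with 0} :=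
  [fsfun mu in S => \sum_(T in LR lam mu) bar_weight T | 0].
(* Both sides are compared after multiplication by the regular element a_rho. *)
exists c; apply: lreg_rho; rewrite alt_schur_sum.
rewrite (@big_fset_incl _ _ _ _ (finsupp c) S); first last.
- by move=> mu _ /fsfun_dflt ->; rewrite scale0r.
- apply/fsubsetP => mu; rewrite mem_finsupp fsfunE.
  by case: ifP; rewrite ?eqxx.
rewrite (eq_big_seq (fun mu => \sum_(T | lr_filling T)
   if mu \in S then if unbarred_mnm (@skew_col n r lam) T 0 == part_mnm mu then
     bar_weight T *: alt 'X_[rho n + part_mnm mu] else 0 else 0)); last first.
  move=> mu mu_in; rewrite fsfunE mu_in scaler_suml (eq_bigl _ _ (LRE mu)).
  by rewrite big_mkcondr.
rewrite exchange_big alt_prod_factorial_schur; apply: eq_bigr => T lrT /=.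
have [nu e] := lr_filling_content lrT.
have content_nu : unbarred_content T = nu :> n.-tuple nat.
  move: e; rewrite -unbarred_contentE => /mnmP e'.
  by apply/eq_from_tnth => k; have := e' k; rewrite !mnmE.
have nu_in : nu \in S.
  rewrite inE mem_pmap; apply/mapP; exists T; first by rewrite mem_enum.
  by rewrite /content content_nu valK.
(* Each filling contributes to its own content [nu] only. *)
rewrite (big_fsetD1 nu) //= nu_in e eqxx big1_fset ?addr0 // => mu.
rewrite !inE (inj_eq part_mnm_inj) => /andP[neq _] _.
by rewrite eq_sym (negbTE neq); case: ifP.
Qed.

End Expansion.

Theorem theorem2p2 (n r : nat) (hn : (1 <= n)%N) (hr : (1 <= r)%N)
    (lam : 'I_r -> npartition n) :
  (exists c : {fsfun npartition n -> Zy r with 0},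
     schur_expansion (\prod_(p < r) factorial_schur (lam p) (yvar p)) c) /\
  (forall c : {fsfun npartition n -> Zy r with 0},
     schur_expansion (\prod_(p < r) factorial_schur (lam p) (yvar p)) c ->
     forall mu : npartition n,
       c mu = \sum_(T in LR lam mu) bar_weight T).
Proof.
split; first exact: LR_schur_expansion.
by move=> c /schur_expansion_coef c_coef mu; rewrite c_coef LR_coef.
Qed.
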